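(* Consider the R-Xi-row iteration defined in the context, under the network, problem and noise assumptions stated there. Let $\Lambda_k=\sum_{t=0}^{k}\lambda_t$ and $\Gamma_k=\sum_{t=0}^{k}\gamma_t$. Suppose that $\{\lambda_k\}$ is nonincreasing with $\lambda_k\in(0,1]$ for all $k\ge 0$, and that $\sum_{k=0}^\infty\lambda_k=\infty$, $\sum_{k=0}^\infty\gamma_k=\infty$, $\lim_{k\to\infty}\frac{1}{\Gamma_k}\sup_{0\le l\le k}\frac{\gamma_l}{\lambda_l}=0$ and $\lim_{k\to\infty}\frac{\Lambda_k}{\Gamma_k}=0$. Suppose further that $\beta_k\in(0,1]$ for all $k$, $\sum_{k=0}^\infty\alpha_k=\infty$, $\sum_{k=0}^\infty\beta_k=\infty$, $\sum_{k=0}^\infty\beta_k^2<\infty$, $\sum_{k=0}^\infty\frac{\alpha_k^2}{\beta_k}<\infty$, $\lim_{k\to\infty}\frac{\alpha_k}{\beta_k}=0$, and $$\sum_{k=0}^{\infty}\alpha_k\left(\frac{1+\sup_{0\le l\le k}\gamma_l/\lambda_l}{\Gamma_k}\right)^2<\infty .$$ Then, for every $i\in\{1,\dots,n\}$, almost surely, $$\lim_{k\to\infty}|x_{i,k}-\tilde x_k|=\lim_{k\to\infty}|z_{i,k}-\tilde z_k|=0,\qquad \lim_{k\to\infty}F(x_{i,k})=F(x^* ).$$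
   Context: Setting (scalar decision variable). There are $n$ agents, $\mathcal V=\{1,\dots,n\}$, with functions $f_i:\mathbb R\to\mathbb R$, $F(x)=\frac1n\sum_{i=1}^n f_i(x)$, and $x^*$ denotes the minimizer of $F$. Network assumption: $W=[W_{ij}]\in\mathbb R^{n\times n}$ is a primitive nonnegative matrix with $W\mathbf 1=\mathbf 1$; here $W_{ij}\in(0,1)$ if $j=i$ or $j$ is an in-neighbor of $i$ in the communication digraph, and $W_{ij}=0$ otherwise. Let $\mathbf r=(r_1,\dots,r_n)^\top$ be the unique positive vector with $\mathbf r^\top W=\mathbf r^\top$ and $\mathbf r^\top\mathbf 1=1$. Problem assumption: each $f_i$ is $\mu$-strongly convex and $L$-smooth (differentiable with $L$-Lipschitz gradient) for some $\mu,L>0$. R-Xi-row iteration. Let $\{\lambda_k\},\{\gamma_k\},\{\alpha_k\},\{\beta_k\}$ be positive (deterministic) gain sequences and $\varepsilon_\kappa>0$ a fixed constant. Initialize with arbitrary $x_{i,0},z_{i,0}\in\mathbb R$, $\mathbf y_{i,0}\in\mathbb R^n$ equal to the $i$-th standard basis vector, and $\kappa_{i,-1}=0$. For $k=0,1,2,\dots$ and each $i\in\mathcal V$, set $\hat{\mathbf y}_{i,k}=\sum_{j}W_{ij}\mathbf y_{j,k}+\mathbf e^y_{i,k}$, $\hat z_{i,k}=\sum_jW_{ij}z_{j,k}+e^z_{i,k}$, $\hat x_{i,k}=\sum_jW_{ij}x_{j,k}+e^x_{i,k}$, and $$\mathbf y_{i,k+1}=(1-\lambda_k)\mathbf y_{i,k}+\lambda_k\hat{\mathbf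 y}_{i,k}+\gamma_k\mathbf y_{i,0},$$ $$\kappa_{i,k}=\frac{\sum_{j=1}^n[\mathbf y_{i,k+1}]_j}{n[\mathbf y_{i,k+1}]_i}\ \text{ if }[\mathbf y_{i,k+1}]_i>\varepsilon_\kappa,\qquad \kappa_{i,k}=\kappa_{i,k-1}\ \text{ otherwise},$$ $$z_{i,k+1}=(1-\beta_k)z_{i,k}+\beta_k\hat z_{i,k}+\alpha_k\kappa_{i,k}\nabla f_i(x_{i,k}),$$ $$x_{i,k+1}=(1-\beta_k)x_{i,k}+\beta_k\hat x_{i,k}-(z_{i,k+1}-z_{i,k}).$$ Here $e^x_{i,k},e^z_{i,k}$ are real random variables and $\mathbf e^y_{i,k}$ are $\mathbb R^n$-valued random vectors. Noise assumption: $e^x_{i,k},\mathbf e^y_{i,k},e^z_{i,k}$ are mutually independent over all $i\in\mathcal V$, $k\ge0$; all are zero-mean with variances uniformly bounded by a constant $\sigma>0$; moreover there is a constant $\tilde\sigma_y$ with $\|\mathbf e^y_{i,k}\|\le\tilde\sigma_y$ for all $i,k$ almost surely. Notation: $\mathbf x_k=(x_{1,k},\dots,x_{n,k})^\top$, $\mathbf z_k=(z_{1,k},\dots,z_{n,k})^\top$, $\tilde x_k=\mathbf r^\top\mathbf x_k$, $\tilde z_k=\mathbf r^\top\mathbf z_k$. *)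

(* Defs.v *)
From HB Require Import structures.
From mathcomp Require Import all_boot all_order all_algebra finmap.
From mathcomp Require Import all_classical all_reals all_analysis.

Set Implicit Arguments.
Unset Strict Implicit.
Unset Printing Implicit Defensive.

Import Order.TTheory GRing.Theory Num.Theory.
Import numFieldNormedType.Exports.

Local Open Scope classical_set_scope.
Local Open Scope ring_scope.

(** * Network *)

Definition primitive_mx (R : numDomainType) (n : nat) (W : 'M[R]_n) :=
  exists2 m : nat, (0 < m)%N & forall i j, 0 < (W ^+ m) i j.

(* [adj j i] is the edge j -> i of the communication digraph, i.e. j is an
   in-neighbor of i. *)
Record network_matrix (R : numDomainType) (n : nat) (adj : rel 'I_n)
    (W : 'M[R]_n) : Prop := NetworkMatrix {
  network_ge0 : forall i j, 0 <= W i j ;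
  network_primitive : primitive_mx W ;
  network_row_stochastic : W *m const_mx 1 = const_mx 1 :> 'cV[R]_n ;
  network_in_neighbor : forall i j, (j == i) || adj j i -> 0 < W i j < 1 ;
  network_not_neighbor : forall i j, ~~ ((j == i) || adj j i) -> W i j = 0 }.

(* These equations determine [r] when [W] is primitive and row stochastic. *)
Record left_perron_vector (R : numDomainType) (n : nat) (W : 'M[R]_n)
    (r : 'cV[R]_n) : Prop := LeftPerronVector {
  perron_gt0 : forall i, 0 < r i 0 ;
  perron_fixed : r^T *m W = r^T ;
  perron_sum1 : \sum_i r i 0 = 1 }.

(** * Objective *)

Definition strongly_convex (R : realType) (mu : R) (f : R -> R) :=
  forall x y t : R, 0 <= t <= 1 ->
    f (t * x + (1 - t) * y)
      <= t * f x + (1 - t) * f y - mu / 2 * t * (1 - t) * (x - y) ^+ 2.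

Definition smooth (R : realType) (L : R) (f : R -> R) :=
  (forall x : R, derivable f x 1) /\ L.-lipschitz (derive1 f).

Definition avg_objective (R : realType) (n : nat) (f : 'I_n -> R -> R) (x : R) : R :=
  n%:R^-1 * \sum_(i < n) f i x.

(** * Noise *)

(* The norm of the library on ['rV_n] is the sup norm. *)
Definition euclidean_norm (R : rcfType) (n : nat) (v : 'rV[R]_n) : R :=
  Num.sqrt (\sum_j v 0 j ^+ 2).

Definition row_of_tuple (R : Type) (n : nat) (t : n.-tuple R) : 'rV[R]_n :=
  \row_j tnth t j.

Definition mutually_independent (d : measure_display) (T : measurableType d)
    (R : realType) (P : probability T R) (I : choiceType)
    (G : I -> set_system T) :=
  forall (J : {fset I}) (A : I -> set T), (forall j, j \in J -> G j (A j)) ->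
    (P (\bigcap_(j in [set` J]) A j) = \prod_(j <- J) P (A j))%E.

Definition sigma_of (d d' : measure_display) (T : measurableType d)
    (T' : measurableType d') (X : T -> T') : set_system T :=
  preimage_set_system setT X measurable.

(* The coordinates of a given [ey i k] may be dependent: each random vector
   contributes a single member to the independent family. *)
Definition noise_sigma (d : measure_display) (T : measurableType d)
    (R : realType) (P : probability T R) (n : nat)
    (ex ez : 'I_n -> nat -> {RV P >-> R})
    (ey : 'I_n -> nat -> {RV P >-> n.-tuple R})
    (a : ('I_n * nat) + ('I_n * nat) + ('I_n * nat)) : set_system T :=
  match a with
  | inl (inl (i, k)) => sigma_of (ex i k)
  | inl (inr (i, k)) => sigma_of (ez i k)
  | inr (i, k) => sigma_of (ey i k)
  end.

(* The variance of a random vector is the trace of its covariance matrix. *)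
Record noise_assumption (d : measure_display) (T : measurableType d)
    (R : realType) (P : probability T R) (n : nat)
    (ex ez : 'I_n -> nat -> {RV P >-> R})
    (ey : 'I_n -> nat -> {RV P >-> n.-tuple R}) (sigma sigma_y : R) : Prop :=
  NoiseAssumption {
  noise_independent : mutually_independent P (noise_sigma ex ez ey) ;
  noise_x_mean : forall i k, ('E_P[ex i k] = 0)%E ;
  noise_z_mean : forall i k, ('E_P[ez i k] = 0)%E ;
  noise_y_mean : forall i k j, ('E_P[fun w => tnth (ey i k w) j] = 0)%E ;
  noise_x_var : forall i k, ('V_P[ex i k] <= sigma%:E)%E ;
  noise_z_var : forall i k, ('V_P[ez i k] <= sigma%:E)%E ;
  noise_y_var : forall i k,
    (\sum_(j < n) 'V_P[fun w => tnth (ey i k w) j] <= sigma%:E)%E ;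
  noise_y_bound : {ae P, forall w, forall i k,
    euclidean_norm (row_of_tuple (ey i k w)) <= sigma_y} }.

(** * The R-Xi-row iteration *)

(* At time k, [st_kappa] holds the value of index k - 1. *)
Record RXi_state (R : Type) (n : nat) := RXiState {
  st_x : 'I_n -> R ;
  st_z : 'I_n -> R ;
  st_y : 'I_n -> 'rV[R]_n ;
  st_kappa : 'I_n -> R }.

Definition RXi_init (R : realType) (n : nat) (x0 z0 : 'I_n -> R) : RXi_state R n :=
  RXiState x0 z0 (fun i => delta_mx 0 i) (fun=> 0).

Definition RXi_step (R : realType) (n : nat) (W : 'M[R]_n) (f : 'I_n -> R -> R)
    (lambda gamma alpha beta : nat -> R) (eps : R)
    (ex ez : 'I_n -> nat -> R) (ey : 'I_n -> nat -> 'rV[R]_n)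
    (k : nat) (s : RXi_state R n) : RXi_state R n :=
  let yhat i := \sum_j W i j *: st_y s j + ey i k in
  let zhat i := \sum_j W i j * st_z s j + ez i k in
  let xhat i := \sum_j W i j * st_x s j + ex i k in
  let y' i := (1 - lambda k) *: st_y s i + lambda k *: yhat i
              + gamma k *: delta_mx 0 i in
  let kappa i := if eps < y' i 0 i then (\sum_j y' i 0 j) / (n%:R * y' i 0 i)
                 else st_kappa s i in
  let z' i := (1 - beta k) * st_z s i + beta k * zhat i
              + alpha k * kappa i * derive1 (f i) (st_x s i) in
  let x' i := (1 - beta k) * st_x s i + beta k * xhat i - (z' i - st_z s i) in
  RXiState x' z' y' kappa.

Fixpoint RXi_row (R : realType) (n : nat) (W : 'M[R]_n) (f : 'I_n -> R -> R)
    (lambda gamma alpha beta : nat -> R) (eps : R) (x0 z0 : 'I_n -> R)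
    (ex ez : 'I_n -> nat -> R) (ey : 'I_n -> nat -> 'rV[R]_n)
    (k : nat) : RXi_state R n :=
  match k with
  | 0 => RXi_init x0 z0
  | k'.+1 => RXi_step W f lambda gamma alpha beta eps ex ez ey k'
      (RXi_row W f lambda gamma alpha beta eps x0 z0 ex ez ey k')
  end%N.

Definition weighted_avg (R : realType) (n : nat) (r : 'cV[R]_n) (x : 'I_n -> R) : R :=
  \sum_i r i 0 * x i.

(** * Gain sequences *)

Definition psum (R : realType) (u : nat -> R) (k : nat) : R :=
  \sum_(0 <= t < k.+1) u t.

Definition sup_ratio (R : realType) (gamma lambda : nat -> R) (k : nat) : R :=
  sup [set gamma l / lambda l | l in [set l | (l <= k)%N]].

(* Main.v *)
(** Proof idea.  The noise enters the [x]- and [z]-recursions only through the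
series [sum_k beta k * e k] of independent centred variables with summable
variances; by Kolmogorov these converge almost surely, and everything else is
pathwise.  Adding the tails of these series to the iterates replaces the noise
by perturbations of size [beta k * o(1)] in the disagreement directions and
by nothing in the direction of the Perron average.  The consensus errors of
[z] and [x] then contract at rate [beta k], in a norm adapted to the primitive
matrix [W], and are forced by [alpha k = o(beta k)] times the gradients.  The
averaged iterate performs gradient descent with step [alpha k] and a relative
error [o(1)], as soon as [kappa] tends to [1 / (n r_i)].  Strong convexity makes
a vanishing relative error harmless: the three errors stay in a box of fixed
proportions and then vanish one after the other.  Finally [kappa] converges for
every bounded noise, because the disagreement and the noise accumulated in
[y] are negligible with respect to [Gamma k]. *)

Require Import Defs.
From HB Require Import structures.
From mathcomp Require Import all_boot all_order all_algebra finmap.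
From mathcomp Require Import all_classical all_reals all_analysis.
From mathcomp Require Import measurable_realfun ring lra.
Import Order.TTheory GRing.Theory Num.Theory.
Import numFieldNormedType.Exports.
Local Open Scope classical_set_scope.
Local Open Scope ring_scope.

(** * Independent series *)

(** The obstacle is that no bound on the iterates is known in advance, so the gradients are not a
    bounded input: they are controlled only by a multiple of [1 + A k + X k], where [A] is the
    distance of the corrected average to the minimizer and [X], [Z] are the disagreements of the
    corrected [x] and [z]. The coupling is nevertheless triangular. The increment [z k.+1 - z k]
    brings [beta k *: (W *m z k - z k)] into the [x] recursion, so [Z] drives [X], and [X] drives
    [A], with constant factors, while every feedback in the other direction carries a factor tending
    to 0. The errors contract on different time scales, [beta k] and [alpha k], so they are not
    added into one potential; a box whose sides have suitable ratios is invariant at either rate.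
    The same increment carries the [z] noise into [x], which is why the correction of [x] is the
    difference of two noise tails. *)

Lemma integral_independent_mul {d : measure_display} {T : measurableType d}
    {R : realType} (P : probability T R) (X Y : {RV P >-> R}) :
  (forall A B : set R, measurable A -> measurable B ->
    P (X @^-1` A `&` Y @^-1` B) = (P (X @^-1` A) * P (Y @^-1` B))%E) ->
  P.-integrable setT (EFin \o X) -> P.-integrable setT (EFin \o Y) ->
  P.-integrable setT (fun w => (X w * Y w)%:E) ->
  (\int[P]_w (X w * Y w)%:E = (\int[P]_w (X w)%:E) * \int[P]_w (Y w)%:E)%E.
Proof.
move=> indXY iX iY iXY.
have mXY : measurable_fun setT (fun w => (X w, Y w)).
  by apply: measurable_fun_pair.
pose Z : {RV P >-> (R * R)%type} :=
  HB.pack (fun w => (X w, Y w)) (isMeasurableFun.Build _ _ _ _ _ mXY).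
pose m (p : R * R) : \bar R := (p.1 * p.2)%:E.
have mf : measurable_fun setT m.
  by apply/measurable_EFinP; apply: measurable_funM.
have -> : (\int[P]_w (X w * Y w)%:E = \int[distribution P Z]_p m p)%E.
  by rewrite integral_distribution.
(* Independence on rectangles identifies the joint law with the product of the marginals, which
   opens the way to Fubini. *)
have prodE : forall A, measurable A ->
    (distribution P X \x distribution P Y)%E A = distribution P Z A.
  apply: product_measure_unique => A B mA mB.
  by rewrite -(indXY A B mA mB).
have mE : measurable_fun [set: R] (@EFin R) by exact: EFin_measurable.
have iA (U : {RV P >-> R}) : P.-integrable setT (EFin \o U) ->
    (\int[distribution P U]_x `|x%:E| < +oo)%E.
  move=> /integrableP[_]; rewrite ge0_integral_distribution//.
  by apply: measurableT_comp => //; exact: mE.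
have iD (U : {RV P >-> R}) : P.-integrable setT (EFin \o U) ->
    (\int[distribution P U]_x x%:E)%E = (\int[P]_w (U w)%:E)%E.
  by move=> iU; rewrite integral_distribution//; exact: mE.
have finE (U : {RV P >-> R}) : P.-integrable setT (EFin \o U) ->
    (\int[distribution P U]_x x%:E)%E \is a fin_num.
  by move=> iU; rewrite iD//; exact: integrable_fin_num.
have iD' (U : {RV P >-> R}) : P.-integrable setT (EFin \o U) ->
    (distribution P U).-integrable setT (@EFin R).
  by move=> iU; apply/integrableP; split => //; exact: iA.
rewrite (eq_measure_integral (distribution P X \x distribution P Y)%E); last first.
  by move=> A mA _; exact/esym/prodE.
rewrite -integral12_prod_meas1; last first.
  (* Tonelli factors the absolute moment into two finite ones; this is the integrability that Fubini
     asks for. *)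
  apply/integrable12ltyP => //; rewrite /m /=.
  have mN : measurable_fun [set: R] (fun y : R => `|y|%:E : \bar R).
    by apply/measurable_EFinP.
  have -> : (\int[distribution P X]_x \int[distribution P Y]_y `|x * y|%:E =
      \int[distribution P X]_x (`|x|%:E * \int[distribution P Y]_y `|y|%:E))%E.
    apply: eq_integral => x _; rewrite -ge0_integralZl//.
    by apply: eq_integral => y _; rewrite -EFinM normrM.
  rewrite ge0_integralZr//; last exact: integral_ge0.
  by apply: lte_mul_pinfty; [exact: integral_ge0| |exact: iA];
    rewrite ge0_fin_numE ?integral_ge0 ?iA.
rewrite /m /= -(iD X)// -(iD Y)//.
have -> : (\int[distribution P X]_x \int[distribution P Y]_y (x * y)%:E =
    \int[distribution P X]_x (x%:E * \int[distribution P Y]_y y%:E))%E.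
  apply: eq_integral => x _; by rewrite -integralZl//; exact: iD'.
by rewrite -[in LHS](fineK (finE _ iY)) integralZr// ?fineK ?finE//; exact: iD'.
Qed.

(** A pi-system generating the sigma-algebra of the first [k] variables. Its members are
    intersections of preimages, the very sets on which [mutually_independent] gives a product
    formula. *)
Definition past {T : Type} {R : realType} (X : nat -> T -> R) (k : nat) :
    set (set T) :=
  [set B | exists2 C : nat -> set R, (forall i, measurable (C i)) &
    B = \bigcap_(i in `I_k) (X i @^-1` C i)].

Section Past.
Context {d : measure_display} {T : measurableType d} {R : realType}.
Variables (P : probability T R) (X : nat -> {RV P >-> R}).
Hypothesis indX : mutually_independent P (fun k => sigma_of (X k)).

Lemma past_setI k : setI_closed (past X k).
Proof.
move=> _ _ [C mC ->] [D mD ->]; exists (fun i => C i `&` D i).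
  by move=> i; exact: measurableI.
by rewrite -bigcapI; apply: eq_bigcapr => i _; rewrite preimage_setI.
Qed.

Lemma past_setT k : past X k setT.
Proof.
by exists (fun=> setT) => //; rewrite bigcapT.
Qed.

Lemma past_measurable k : past X k `<=` measurable.
Proof.
move=> _ [C mC ->]; apply: bigcap_measurableType => i _.
by rewrite -[X in measurable X]setTI; exact: measurable_funP.
Qed.

Lemma past_mono k : past X k `<=` past X k.+1.
Proof.
move=> _ [C mC ->]; exists (fun i => if (i < k)%N then C i else setT).
  by move=> i; case: ifP.
apply/seteqP; split=> w H i /= ik.
  by case: ifPn => // ik'; exact: H.
by have := H i (ltnW ik); rewrite /= ik.
Qed.

Lemma past_last k (C : set R) : measurable C -> past X k.+1 (X k @^-1` C).
Proof.
move=> mC; exists (fun i => if i == k then C else setT).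
  by move=> i; case: ifP.
apply/seteqP; split=> w H.
  by move=> i /= ik; case: ifPn => // /eqP ->.
by have := H k (ltnSn k); rewrite /= eqxx.
Qed.

Lemma past_probability k (C : nat -> set R) : (forall i, measurable (C i)) ->
  P (\bigcap_(i in `I_k) (X i @^-1` C i)) =
  (\prod_(0 <= i < k) P (X i @^-1` C i))%E.
Proof.
move=> mC; pose J : {fset nat} := [fset i | i in iota 0 k]%fset.
have memJ i : (i \in J) = (i < k)%N by rewrite !inE /= mem_iota.
have := indX J (fun i => X i @^-1` C i).
rewrite (_ : [set` J] = `I_k); last by apply/seteqP; split=> i /=; rewrite memJ.
move=> ->; last by move=> i _; exists (C i) => //; rewrite setTI.
apply: perm_big; apply: uniq_perm; rewrite ?fset_uniq ?iota_uniq//.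
by move=> i; rewrite memJ mem_index_iota.
Qed.

(** As functions of [B] both sides are finite measures. They agree on the pi-system [past X k], by
    independence of [k + 1] variables, hence on the sigma-algebra that it generates. *)
Lemma past_independent k (B : set T) (C : set R) :
  <<s past X k >> B -> measurable C ->
  P (B `&` X k @^-1` C) = (P B * P (X k @^-1` C))%E.
Proof.
move=> sB mC; set E := X k @^-1` C.
have mE : measurable E.
  by rewrite -[X in measurable X]setTI; exact: measurable_funP.
have pE0 : 0 <= fine (P E) by exact: fine_ge0.
rewrite [RHS]muleC -[in RHS](@fineK _ (P E)) ?fin_num_measure//.
rewrite -[LHS]/(mrestr P mE B) -[RHS]/(mscale (NngNum pE0) P B).
apply: (g_sigma_algebra_measure_unique (past X k) (@past_measurable k)
  (fun=> setT)) => //.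
- by move=> _; exact: past_setT.
- by rewrite bigcup_const//; exists 0%N.
- exact: past_setI.
- move=> _ [D mD ->]; set B' := bigcap _ _.
  change (P (B' `&` E) = ((fine (P E))%:E * P B')%E); rewrite {}/B'.
  pose D' i := if (i < k)%N then D i else C.
  have mD' i : measurable (D' i) by rewrite /D'; case: ifP.
  have -> : \bigcap_(i in `I_k) (X i @^-1` D i) `&` E =
            \bigcap_(i in `I_k.+1) (X i @^-1` D' i).
    apply/seteqP; split=> [w [HD HE] i /= ik|w H].
      rewrite /D'; case: ifPn => [ik'|]; first exact: HD.
      rewrite -leqNgt => ki.
      suff -> : i = k by [].
      by apply/eqP; rewrite eqn_leq ki -ltnS ik.
    split=> [i /= ik|]; last by have := H k (ltnSn k); rewrite /D' /= ltnn.
    by have := H i (ltnW ik); rewrite /D' /= ik.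
  rewrite !past_probability// big_nat_recr//= /D' ltnn muleC fineK ?fin_num_measure//.
  by congr (_ * _)%E; rewrite !big_nat; apply: eq_bigr => i /andP[_ ->].
- move=> _; change (P (setT `&` E) < +oo)%E; rewrite setTI; apply: le_lt_trans (ltry 1).
  exact: probability_le1.
Qed.

Lemma past_measurable_funS k (f : T -> R) :
  measurable_fun (setT : set (g_sigma_algebraType (past X k)))
    (f : g_sigma_algebraType (past X k) -> R) ->
  measurable_fun (setT : set (g_sigma_algebraType (past X k.+1)))
    (f : g_sigma_algebraType (past X k.+1) -> R).
Proof.
move=> mf _ Y mY; move: (mf measurableT _ mY).
apply: (@sub_sigma_algebra2 T setT (past X k.+1) (past X k)).
exact: past_mono.
Qed.

Lemma past_measurable_fun k (f : T -> R) :
  measurable_fun (setT : set (g_sigma_algebraType (past X k)))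
    (f : g_sigma_algebraType (past X k) -> R) ->
  measurable_fun setT f.
Proof.
move=> mf _ Y mY; move: (mf measurableT _ mY).
apply: smallest_sub; first exact: sigma_algebra_measurable.
exact: past_measurable.
Qed.

Lemma past_fun_independent k (f : {RV P >-> R}) :
  measurable_fun (setT : set (g_sigma_algebraType (past X k)))
    (f : g_sigma_algebraType (past X k) -> R) ->
  forall A B : set R, measurable A -> measurable B ->
    P (f @^-1` A `&` X k @^-1` B) = (P (f @^-1` A) * P (X k @^-1` B))%E.
Proof.
move=> mf A B mA mB; apply: past_independent => //.
by have := mf measurableT _ mA; rewrite setTI.
Qed.

End Past.

Lemma integrable_dominated {d : measure_display} {T : measurableType d}
    {R : realType} (P : probability T R) (f g : T -> R) :
  measurable_fun setT f -> P.-integrable setT (EFin \o g) ->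
  (forall w, `|f w| <= g w) -> P.-integrable setT (EFin \o f).
Proof.
move=> mf ig fg; apply: le_integrable ig => //.
  exact/measurable_EFinP.
by move=> w _; rewrite lee_fin (le_trans (fg w))// ler_norm.
Qed.

Lemma integrable_lincomb {d : measure_display} {T : measurableType d}
    {R : realType} (P : probability T R) (a b : R) (f g : T -> R) :
  P.-integrable setT (EFin \o f) -> P.-integrable setT (EFin \o g) ->
  P.-integrable setT (EFin \o (fun w => a * f w + b * g w)).
Proof.
move=> iF iG.
have -> : EFin \o (fun w => a * f w + b * g w) =
    (fun w => a%:E * (EFin \o f) w + b%:E * (EFin \o g) w)%E.
  by apply/funext => w.
by apply: integrableD => //; exact: integrableZl.
Qed.

Lemma integral_lincomb {d : measure_display} {T : measurableType d}
    {R : realType} (P : probability T R) (a b : R) (f g : T -> R) :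
  P.-integrable setT (EFin \o f) -> P.-integrable setT (EFin \o g) ->
  (\int[P]_w (a * f w + b * g w)%:E =
   a%:E * (\int[P]_w (f w)%:E) + b%:E * \int[P]_w (g w)%:E)%E.
Proof.
move=> iF iG; under eq_integral do rewrite EFinD !EFinM.
by rewrite integralD ?integralZl//; exact: integrableZl.
Qed.

Lemma measurable_fun_natr_ltr {d : measure_display} {T : measurableType d}
    {R : realType} (f g : T -> R) :
  measurable_fun setT f -> measurable_fun setT g ->
  measurable_fun setT (fun w => (f w < g w)%R%:R : R).
Proof.
move=> mf mg; rewrite (_ : (fun _ => _) = fun w => if f w < g w then 1 else 0).
  by apply: measurable_fun_ifT => //; exact: measurable_fun_ltr.
by apply/funext => w; case: (_ < _).
Qed.

(* The partial sums of [b k * X k], frozen once their modulus reaches [e]: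
   Chebyshev's inequality for the frozen sum is Kolmogorov's maximal inequality. *)
Fixpoint stopped_sum {T : Type} {R : realType} (b : nat -> R)
    (X : nat -> T -> R) (e : R) (m : nat) (w : T) : R :=
  if m is m'.+1 then
    let v := stopped_sum b X e m' w in
    v + b m' * ((`|v| < e)%R%:R * X m' w)
  else 0.

(** A frozen sum keeps its modulus of at least [e] forever, so a value below [e] at time [m]
    certifies that freezing never happened. *)
Lemma stopped_sumP {T : Type} {R : realType} (b : nat -> R)
    (X : nat -> T -> R) (e : R) (m : nat) (w : T) :
  `|stopped_sum b X e m w| < e ->
  stopped_sum b X e m w = \sum_(0 <= k < m) b k * X k w /\
  (forall k, (k <= m)%N -> `|\sum_(0 <= j < k) b j * X j w| < e).
Proof.
elim: m => [/= e0|m IH /=].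
  rewrite big_nil; split => // k; rewrite leqn0 => /eqP ->.
  by rewrite big_nil.
case: (ltP `|stopped_sum b X e m w| e) => [lt_e|ge_e]; last first.
  by rewrite mul0r mulr0 addr0 => /(le_lt_trans ge_e); rewrite ltxx.
have [VE SE] := IH lt_e.
rewrite mul1r VE -big_nat_recr//= => lt_e'; split => // k.
by rewrite leq_eqVlt ltnS => /orP[/eqP ->//|]; exact: SE.
Qed.

(** * Kolmogorov's maximal inequality *)

Section StoppedSum.
Context {d : measure_display} {T : measurableType d} {R : realType}.
Variables (P : probability T R) (X : nat -> {RV P >-> R}) (b : nat -> R) (e s : R).
Hypothesis indX : mutually_independent P (fun k => sigma_of (X k)).
Hypothesis X_mean : forall k, (\int[P]_w (X k w)%:E = 0)%E.
Hypothesis X_var : forall k, (\int[P]_w (X k w ^+ 2)%:E <= s%:E)%E.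
Local Notation V := (stopped_sum b X e).

Lemma stopped_sum_past k :
  measurable_fun (setT : set (g_sigma_algebraType (past X k)))
    (V k : g_sigma_algebraType (past X k) -> R).
Proof.
elim: k => [|k IH] /=; first exact: measurable_cst.
have mV := past_measurable_funS P X _ _ IH.
apply: measurable_funD => //.
apply: measurable_funM => //.
apply: measurable_funM.
  apply: measurable_fun_natr_ltr => //; exact: measurableT_comp.
move=> _ Y mY; rewrite setTI; apply: sub_sigma_algebra.
exact: past_last.
Qed.

Lemma stopped_sum_measurable k : measurable_fun setT (V k).
Proof. exact: (past_measurable_fun P X _ _ (stopped_sum_past k)). Qed.

Lemma X_sq_integrable k : P.-integrable setT (EFin \o (fun w => X k w ^+ 2)).
Proof.
apply/integrableP; split.
  by apply/measurable_EFinP; apply: measurable_funX.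
apply: le_lt_trans (ltry s); apply: le_trans (X_var k).
apply: ge0_le_integral => //=.
- apply/measurable_EFinP; apply: measurableT_comp => //.
  exact: measurable_funX.
- by apply/measurable_EFinP; apply: measurable_funX.
- by move=> w _; rewrite lee_fin ger0_norm// sqr_ge0.
Qed.

Lemma integrable_of_sq (f : T -> R) : measurable_fun setT f ->
  P.-integrable setT (EFin \o (fun w => f w ^+ 2)) ->
  P.-integrable setT (EFin \o f).
Proof.
move=> mf if2; have i1 : P.-integrable setT (EFin \o (fun=> 1 : R)).
  exact: finite_measure_integrable_cst.
apply: (integrable_dominated _ _ _ mf (integrable_lincomb P 1 1 _ _ i1 if2)).
move=> w; rewrite !mul1r -normr_id -(real_normK (num_real (f w))).
set u := `|f w|; rewrite ger0_norm ?/u//.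
have := sqr_ge0 (u - 2^-1); rewrite /u; nra.
Qed.

(** The increments are orthogonal: [phi] depends on the past only, so the cross term [phi w * X m w]
    has mean 0. The indicator can only lower the square of the new increment. *)
Lemma stopped_sum_second_moment m :
  P.-integrable setT (EFin \o (fun w => V m w ^+ 2)) /\
  (\int[P]_w (V m w ^+ 2)%:E <= (s * \sum_(0 <= k < m) b k ^+ 2)%:E)%E.
Proof.
elim: m => [|m [iV2 EV2]].
  rewrite big_nil mulr0; split; last first.
    by rewrite /= expr0n/= integral0.
  by rewrite /= expr0n/=; exact: integrable0.
have mV := stopped_sum_measurable m.
have mI : measurable_fun setT (fun w => (`|V m w| < e)%R%:R : R).
  by apply: measurable_fun_natr_ltr => //; exact: measurableT_comp.
pose phi w := V m w * (`|V m w| < e)%R%:R.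
have mphi : measurable_fun setT phi by exact: measurable_funM.
have mX k : measurable_fun setT (X k) by [].
have iX2 := X_sq_integrable m.
have iX := integrable_of_sq _ (mX m) iX2.
have iVX := integrable_lincomb P 1 1 _ _ iV2 iX2.
have bool01 (c : bool) : (c%:R : R) = 0 \/ (c%:R : R) = 1 by case: c; [right|left].
have iphiX : P.-integrable setT (EFin \o (fun w => phi w * X m w)).
  apply: integrable_dominated iVX _; first exact: measurable_funM.
  move=> w; rewrite !mul1r ler_norml /phi.
  have := sqr_ge0 (V m w - X m w); have := sqr_ge0 (V m w + X m w).
  by case: (bool01 (`|V m w| < e)) => ->; nra.
have iphi : P.-integrable setT (EFin \o phi).
  apply: integrable_of_sq => //.
  apply: (integrable_dominated _ _ _ _ iV2); first exact: measurable_funX.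
  move=> w; rewrite ger0_norm ?sqr_ge0// /phi.
  by case: (bool01 (`|V m w| < e)) => ->; nra.
have E0 : (\int[P]_w (phi w * X m w)%:E = 0)%E.
  pose Phi : {RV P >-> R} := HB.pack phi (isMeasurableFun.Build _ _ _ _ _ mphi).
  have := @integral_independent_mul _ _ _ P Phi (X m).
  rewrite X_mean mule0; apply => //.
  apply: past_fun_independent => //; apply: measurable_funM.
    exact: stopped_sum_past.
  apply: measurable_fun_natr_ltr => //; apply: measurableT_comp => //.
  exact: stopped_sum_past.
have i1 := integrable_lincomb P 1 (2 * b m) _ _ iV2 iphiX.
have i2 := integrable_lincomb P 1 (b m ^+ 2) _ _ i1 iX2.
have leV w : V m.+1 w ^+ 2 <=
    1 * (1 * V m w ^+ 2 + 2 * b m * (phi w * X m w)) + b m ^+ 2 * X m w ^+ 2.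
  rewrite /= /phi; have := sqr_ge0 (b m * X m w).
  by case: (bool01 (`|V m w| < e)) => ->; nra.
have iV2' : P.-integrable setT (EFin \o (fun w => V m.+1 w ^+ 2)).
  apply: integrable_dominated i2 _.
    exact/measurable_funX/stopped_sum_measurable.
  by move=> w; rewrite ger0_norm ?sqr_ge0.
split => //.
apply: (@le_trans _ _ (\int[P]_w (1 * (1 * V m w ^+ 2 + 2 * b m * (phi w * X m w))
    + b m ^+ 2 * X m w ^+ 2)%:E)%E).
  by apply: le_integral => // w _; rewrite lee_fin.
rewrite integral_lincomb// integral_lincomb// E0 mule0 adde0 !mul1e.
rewrite big_nat_recr//= mulrDr EFinD; apply: leeD => //.
have -> : (s * b m ^+ 2)%:E = ((b m ^+ 2)%:E * s%:E)%E by rewrite -EFinM mulrC.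
by apply: (@lee_wpmul2l R); rewrite ?lee_fin ?sqr_ge0.
Qed.

Lemma stopped_sum_maximal m : 0 < e ->
  ((e ^+ 2)%:E * P [set w | (e <= `|V m w|)%R ]
   <= (s * \sum_(0 <= k < m) b k ^+ 2)%:E)%E.
Proof.
move=> e0; have mV := stopped_sum_measurable m.
pose Vm : {RV P >-> R} := HB.pack (V m) (isMeasurableFun.Build _ _ _ _ _ mV).
have [_] := stopped_sum_second_moment m; apply: le_trans.
have := @markov _ _ _ P Vm (fun r => r ^+ 2) e e0.
rewrite unlock /=; under eq_integral do rewrite /= real_normK ?num_real//.
apply => //; first by move=> r _; exact: sqr_ge0.
by move=> x y x0 y0 xy; rewrite lerXn2r.
Qed.

End StoppedSum.

Lemma nneseries_tail_small {R : realType} (u : nat -> R) (eta : R) :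
  (forall k, 0 <= u k) -> (\sum_(0 <= k <oo) (u k)%:E < +oo)%E -> 0 < eta ->
  exists N, forall m, \sum_(N <= k < m) u k <= eta.
Proof.
move=> u0 su eta0.
have := nneseries_tail_cvg su (fun k _ => u0 k).
move=> /fine_cvgP[fin_tail /cvgrPdist_lt /(_ _ eta0) small_tail].
near \oo => N; exists N => m.
have tailN : (\sum_(N <= k <oo) (u k)%:E)%E \is a fin_num by near: N.
have : `|0 - fine (\sum_(N <= k <oo) (u k)%:E)%E| < eta by near: N.
rewrite sub0r normrN => /(le_lt_trans (ler_norm _)) /ltW; apply: le_trans.
rewrite -lee_fin fineK// -sumEFin; apply: nneseries_lim_ge => k _ _.
by rewrite lee_fin.
Unshelve. all: by end_near.
Qed.

(** * Almost sure convergence of the weighted noise series *)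

Section IndependentSeries.
Context {d : measure_display} {T : measurableType d} {R : realType}.
Variables (P : probability T R) (X : nat -> {RV P >-> R}) (b : nat -> R) (s : R).
Hypothesis indX : mutually_independent P (fun k => sigma_of (X k)).
Hypothesis X_mean : forall k, (\int[P]_w (X k w)%:E = 0)%E.
Hypothesis X_var : forall k, (\int[P]_w (X k w ^+ 2)%:E <= s%:E)%E.
Hypothesis b_sq : (\sum_(0 <= k <oo) (b k ^+ 2)%:E < +oo)%E.

(** Zeroing the first [N] coefficients lets sums that start at [N] be treated as stopped sums from
    0. *)
Let bN N k := if (N <= k)%N then b k else 0.
Let D e N M := [set w | e <= `|stopped_sum (bN N) X e M w| ].

Let mD e N M : measurable (D e N M).
Proof.
rewrite -[D _ _ _]setTI; apply: measurable_fun_le => //.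
by apply: measurableT_comp => //; exact: stopped_sum_measurable.
Qed.

(** Freezing expresses that some earlier sum reached [e] through the last value alone; continuity
    from below then bounds the union over [M]. *)
Let D_homo e N : nondecreasing_seq (D e N).
Proof.
apply/nondecreasing_seqP => M; apply/subsetPset => w; rewrite /D /= => eV.
by rewrite ltNge eV /= mul0r mulr0 addr0.
Qed.

Let D_bound e N m eta : 0 < e -> 0 <= s ->
  (forall m, \sum_(N <= k < m) b k ^+ 2 <= eta) ->
  ((e ^+ 2)%:E * P (D e N m) <= (s * eta)%:E)%E.
Proof.
move=> e0 s0 H.
apply: le_trans (stopped_sum_maximal _ _ _ _ _ indX X_mean X_var _ e0) _.
rewrite lee_fin ler_wpM2l//; apply: le_trans (H m).
rewrite le_eqVlt; apply/orP; left; apply/eqP.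
have [Nm|mN] := leqP N m.
  rewrite (big_cat_nat _ Nm)//= big_nat big1 ?add0r; last first.
    by move=> k /andP[_ kN]; rewrite /bN leqNgt kN /= expr0n.
  by rewrite !big_nat; apply: eq_bigr => k /andP[Nk _]; rewrite /bN Nk.
rewrite [RHS]big_geq ?(ltnW mN)// big_nat big1// => k /andP[_ km].
by rewrite /bN leqNgt (ltn_trans km mN)/= expr0n.
Qed.

Let D_null e : 0 < e -> P.-negligible (\bigcap_N \bigcup_M D e N M).
Proof.
move=> e0.
have mU N : measurable (\bigcup_M D e N M) by exact: bigcup_measurable.
have mI : measurable (\bigcap_N \bigcup_M D e N M) by exact: bigcap_measurableType.
have s0 : 0 <= s.
  rewrite -lee_fin; apply: le_trans (X_var 0%N); apply: integral_ge0 => w _.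
  by rewrite lee_fin sqr_ge0.
apply/negligibleP => //; apply/eqP; rewrite eq_le measure_ge0 andbT.
apply/lee_addgt0Pr => eta eta0; rewrite add0e.
(* Chebyshev's inequality costs the factor [s / e ^+ 2]; [s + 1] stands in for [s], which may be
   0. *)
pose delta := e ^+ 2 * eta / (s + 1).
have s1 : 0 < s + 1 by rewrite ltr_wpDl.
have delta0 : 0 < delta by rewrite /delta divr_gt0// mulr_gt0// exprn_gt0.
have [N HN] := nneseries_tail_small (fun k => b k ^+ 2) delta (fun k => sqr_ge0 _)
   b_sq delta0.
have PU : (P (\bigcup_M D e N M) <= eta%:E)%E.
  rewrite -(cvg_lim _ (nondecreasing_cvg_mu (mD e N) (mU N) (D_homo e N)))//.
  apply: lime_le; first exact: (cvgP _ (nondecreasing_cvg_mu (mD e N) (mU N) (D_homo e N))).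
  apply: nearW => M /=; have := D_bound _ _ M _ e0 s0 HN.
  rewrite -[P (D _ _ _)]fineK ?fin_num_measure// -EFinM !lee_fin => H.
  rewrite -(ler_pM2l (exprn_gt0 2 e0)); apply: le_trans H _.
  rewrite /delta mulrCA ler_piMr ?ler_pdivrMr ?mul1r ?lerDl//.
  by rewrite mulr_ge0 ?sqr_ge0// ltW.
apply: le_trans PU.
by apply: le_measure; rewrite ?inE//; exact: bigcap_inf.
Qed.

(** Off a null set, each scale [e p] admits an [N] from which no sum reaches [e p]. A block of terms
    beyond [N] is a difference of two such sums, so the Cauchy criterion holds. *)
Lemma independent_series_cvg :
  {ae P, forall w, cvgn (fun m => \sum_(0 <= k < m) b k * X k w)}.
Proof.
pose e p : R := p.+1%:R^-1.
have e0 p : 0 < e p by rewrite invr_gt0.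
apply: (@negligibleS _ _ _ _ (\bigcup_p \bigcap_N \bigcup_M D (e p) N M)); last first.
  by apply: negligible_bigcup => p; exact: D_null.
move=> w; apply: contra_notP => H.
suff : cvgn (series (fun k => b k * X k w)) by rewrite seriesEnat.
apply/cauchy_cvgP/cauchy_seriesP => eps eps0.
have [p ep] : exists p, e p + e p < eps.
  near \oo => p; exists p; rewrite (_ : e p + e p = e p * 2); last by lra.
  rewrite -ltr_pdivlMr//.
  near: p; have e2 : 0 < eps / 2 by rewrite divr_gt0.
  exact: (near_infty_natSinv_lt (PosNum e2)).
have [N HN] : exists N, forall M, `|stopped_sum (bN N) X (e p) M w| < e p.
  apply: contrapT => HN; apply: H; exists p => // N _.
  apply: contrapT => HM; apply: HN; exists N => M; rewrite ltNge.
  by apply/negP => eM; apply: HM; exists M.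
have S m : `|\sum_(N <= k < m) b k * X k w| < e p.
  have [mN|Nm] := leqP m N; first by rewrite big_geq// normr0.
  have [_ /(_ m (leqnn m))] := stopped_sumP _ _ _ _ _ (HN m).
  rewrite (big_cat_nat _ (ltnW Nm))//= big_nat big1 ?add0r; last first.
    by move=> k /andP[_ kN]; rewrite /bN leqNgt kN mul0r.
  rewrite big_nat; under eq_bigr => k /andP[Nk _] do rewrite /bN Nk.
  by rewrite -big_nat.
exists ([set n | (N <= n)%N], [set n | (N <= n)%N]); first by split; exists N.
move=> [n m] [/= Nn Nm]; have [mn|nm] := leqP m n; first by rewrite big_geq// normr0.
have -> : \sum_(n <= k < m) b k * X k w =
    \sum_(N <= k < m) b k * X k w - \sum_(N <= k < n) b k * X k w.
  by rewrite (big_cat_nat Nn (ltnW nm))//= [X in X - _]addrC addrK.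
apply: le_lt_trans ep; apply: le_trans (ler_normB _ _) _.
by apply: lerD; exact/ltW.
Unshelve. all: by end_near.
Qed.

End IndependentSeries.

(** * Scalar recursions *)

(** With the drive below [a], half of [c * eta], every step taken above [eta] descends by at least
    [b k * a], so divergence of the steps forces a visit below [eta]. From there [u] cannot escape,
    since [a <= c * eta]. *)
Lemma recursion_cvg0 {R : realType} (u b e : nat -> R) (c : R) :
  0 < c -> (forall k, 0 <= u k) -> (forall k, 0 < b k) ->
  (\forall k \near \oo, c * b k <= 1) ->
  (forall N A, exists m, A <= \sum_(N <= k < m) b k) ->
  e @ \oo --> 0 ->
  (\forall k \near \oo, u k.+1 <= (1 - c * b k) * u k + b k * e k) ->
  u @ \oo --> 0.
Proof.
move=> c0 u0 b0 cb1 bdiv e_cvg rec; apply/cvgrPdist_le => eta eta0.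
pose a := c * eta / 2; have a0 : 0 < a by rewrite /a divr_gt0// mulr_gt0.
have [N _ HN] : \forall k \near \oo, [/\ c * b k <= 1, e k <= a &
    u k.+1 <= (1 - c * b k) * u k + b k * e k].
  near=> k; split; [by near: k| |by near: k].
  have : `|0 - e k| < a by near: k; move/cvgrPdist_lt : e_cvg; apply.
  by rewrite sub0r normrN => /ltW /(le_trans (ler_norm _)).
have step k : (N <= k)%N -> u k.+1 <= (1 - c * b k) * u k + b k * a.
  move=> /HN[_ ea]; move/le_trans; apply; rewrite lerD2l ler_wpM2l//.
  exact/ltW.
have [k0 Nk0 uk0] : exists2 k, (N <= k)%N & u k <= eta.
  apply: contrapT => H.
  have gt_eta k : (N <= k)%N -> eta < u k.
    by move=> Nk; rewrite ltNge; apply/negP => ule; apply: H; exists k.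
  have dec m : u (N + m)%N <= u N - a * \sum_(N <= k < N + m) b k.
    elim: m => [|m IH]; first by rewrite addn0 big_geq// mulr0 subr0.
    rewrite addnS big_nat_recr ?leq_addr//= mulrDr.
    have NNm : (N <= N + m)%N by rewrite leq_addr.
    have := step _ NNm.
    have : 0 <= c * b (N + m)%N * (u (N + m)%N - eta).
      by rewrite mulr_ge0 ?subr_ge0 ?(ltW (gt_eta _ NNm))// mulr_ge0// ltW.
    move: IH; set S := \sum_(_ <= _ < _) _; rewrite /a; lra.
  (* A total step of this size would push [u] down to [-1]. *)
  have [m Am] := bdiv N ((u N + 1) / a).
  have [Nm|mN] := leqP N m.
    have := dec (m - N)%N; rewrite subnKC//; have := u0 m.
    by move: Am; rewrite ler_pdivrMr// mulrC => Am u0m; lra.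
  move: Am; rewrite big_geq ?(ltnW mN)// leNgt divr_gt0//.
  by rewrite ltr_wpDl.
exists k0 => // k /= k0k; rewrite sub0r normrN ger0_norm//.
rewrite -(subnKC k0k); elim: (k - k0)%N => [|m IH]; first by rewrite addn0.
have Nk : (N <= k0 + m)%N by rewrite (leq_trans Nk0)// leq_addr.
rewrite addnS; apply: le_trans (step _ Nk) _.
have [cb _ _] := HN _ Nk.
have : (1 - c * b (k0 + m)%N) * u (k0 + m)%N <= (1 - c * b (k0 + m)%N) * eta.
  by rewrite ler_wpM2l// subr_ge0.
have : 0 <= c * b (k0 + m)%N * eta by rewrite !mulr_ge0// ltW.
by rewrite /a; lra.
Unshelve. all: by end_near.
Qed.

Lemma nneseries_oo_partial {R : realType} (b : nat -> R) :
  (forall k, 0 <= b k) -> (\sum_(0 <= k <oo) (b k)%:E = +oo)%E ->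
  forall N A, exists m, A <= \sum_(N <= k < m) b k.
Proof.
move=> b0 boo N A; apply: contrapT => H.
have lt_A m : \sum_(N <= k < m) b k < A.
  by rewrite ltNge; apply/negP => Am; apply: H; exists m.
have : (\sum_(0 <= k <oo) (b k)%:E <= (\sum_(0 <= k < N) b k + A)%:E)%E.
  apply: lime_le; first by apply: is_cvg_nneseries => k _ _; rewrite lee_fin.
  apply: nearW => m; rewrite sumEFin lee_fin; have [mN|Nm] := leqP m N.
    rewrite [in leRHS](big_cat_nat _ mN)//= -addrA lerDl addr_ge0 ?sumr_ge0//.
    by apply: le_trans (ltW (lt_A N)); rewrite big_geq.
  by rewrite (big_cat_nat _ (ltnW Nm))//= lerD2l ltW.
by rewrite boo leye_eq.
Qed.

Lemma coupled_recursion_cvg0 {R : realType} (A X Z alpha beta eps : nat -> R)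
    (c mu D : R) :
  0 < c -> 0 < mu -> 0 < D ->
  (forall k, 0 <= A k) -> (forall k, 0 <= X k) -> (forall k, 0 <= Z k) ->
  (forall k, 0 < alpha k) -> (forall k, 0 < beta k) -> (forall k, 0 <= eps k) ->
  (forall k, c * beta k <= 1) -> (\forall k \near \oo, mu * alpha k <= 1) ->
  (forall N B, exists m, B <= \sum_(N <= k < m) alpha k) ->
  (forall N B, exists m, B <= \sum_(N <= k < m) beta k) ->
  eps @ \oo --> 0 ->
  (\forall k \near \oo,
    [/\ Z k.+1 <= (1 - c * beta k) * Z k + beta k * (eps k * (1 + A k + X k)),
        X k.+1 <= (1 - c * beta k) * X k +
                  beta k * (D * Z k + eps k * (1 + A k + X k)) &
        A k.+1 <= (1 - mu * alpha k) * A k +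
                  alpha k * (D * X k + eps k * (1 + A k + X k))]) ->
  [/\ A @ \oo --> 0, X @ \oo --> 0 & Z @ \oo --> 0].
Proof.
move=> c0 mu0 D0 A0 X0 Z0 al0 be0 ep0 cb mua alpha_div beta_div eps_cvg rec.
(* The box [A <= B], [X <= p * B], [Z <= q * B] is invariant once [eps k] is
   small, for every [B >= 1]. *)
pose p := mu / (2 * D); pose q := c * p / (2 * D).
have p0 : 0 < p by rewrite divr_gt0// mulr_gt0.
have q0 : 0 < q by rewrite divr_gt0// mulr_gt0.
(* The ratios are chosen so that a driver at its own bound consumes half of the contraction opposing
   it, which leaves the other half for the error term. *)
have Dp : D * p = mu / 2 by rewrite /p; field; rewrite gt_eqF.
have Dq : D * q = c * p / 2 by rewrite /q; field; rewrite gt_eqF.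
(* Inside the box [1 + A k + X k <= (2 + p) * B]; [e0] keeps the error within the slack of all three
   recursions. [Z] has no driver, so its slack is the whole [c * q]. *)
pose e0 := Num.min (c * q) (Num.min (c * p / 2) (mu / 2)) / (2 + p).
have p2 : 0 < 2 + p by rewrite addr_gt0.
have e0_gt0 : 0 < e0.
  by rewrite divr_gt0// !lt_min mulr_gt0//= !divr_gt0// mulr_gt0.
have e0E : e0 * (2 + p) = Num.min (c * q) (Num.min (c * p / 2) (mu / 2)).
  by rewrite /e0 divfK// gt_eqF.
have e0q : e0 * (2 + p) <= c * q by rewrite e0E ge_min lexx.
have e0p : e0 * (2 + p) <= c * p / 2 by rewrite e0E !ge_min lexx orbT.
have e0mu : e0 * (2 + p) <= mu / 2 by rewrite e0E !ge_min lexx !orbT.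
have [N _ HN] : \forall k \near \oo, [/\ eps k <= e0, mu * alpha k <= 1 &
    [/\ Z k.+1 <= (1 - c * beta k) * Z k + beta k * (eps k * (1 + A k + X k)),
        X k.+1 <= (1 - c * beta k) * X k +
                  beta k * (D * Z k + eps k * (1 + A k + X k)) &
        A k.+1 <= (1 - mu * alpha k) * A k +
                  alpha k * (D * X k + eps k * (1 + A k + X k))]].
  near=> k; split; [|by near: k|by near: k].
  have : `|0 - eps k| < e0 by near: k; move/cvgrPdist_lt : eps_cvg; apply.
  by rewrite sub0r normrN => /ltW /(le_trans (ler_norm _)).
pose B := 1 + A N + X N / p + Z N / q.
have B1 : 1 <= B by rewrite /B -!addrA lerDl !addr_ge0// divr_ge0// ltW.
have B0 : 0 < B by rewrite (lt_le_trans ltr01).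
have bounded k : (N <= k)%N -> [/\ A k <= B, X k <= p * B & Z k <= q * B].
  move=> Nk; rewrite -(subnKC Nk); elim: (k - N)%N => [|m IH].
    rewrite addn0; have Xp : 0 <= X N / p by rewrite divr_ge0// ltW.
    have Zq : 0 <= Z N / q by rewrite divr_ge0// ltW.
    have AN := A0 N; split; first by rewrite /B; lra.
      by rewrite mulrC -ler_pdivrMr// /B; lra.
    by rewrite mulrC -ler_pdivrMr// /B; lra.
  have Nm : (N <= N + m)%N by rewrite leq_addr.
  have [epm mum [HZ HX HA]] := HN _ Nm; rewrite addnS.
  move: IH HZ HX HA; set j := (N + m)%N => -[IA IX IZ] HZ HX HA.
  have E : eps j * (1 + A j + X j) <= e0 * (2 + p) * B.
    rewrite -mulrA; apply: ler_pM => //; first by rewrite !addr_ge0.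
    by rewrite mulrDl; lra.
  have Eq : eps j * (1 + A j + X j) <= c * q * B.
    by apply: (le_trans E); rewrite ler_pM2r.
  have Ep : eps j * (1 + A j + X j) <= c * p / 2 * B.
    by apply: (le_trans E); rewrite ler_pM2r.
  have Emu : eps j * (1 + A j + X j) <= mu / 2 * B.
    by apply: (le_trans E); rewrite ler_pM2r.
  have cbj : 0 <= 1 - c * beta j by rewrite subr_ge0.
  have maj : 0 <= 1 - mu * alpha j by rewrite subr_ge0.
  have DZ : D * Z j <= c * p / 2 * B by rewrite -Dq -mulrA ler_pM2l.
  have DX : D * X j <= mu / 2 * B by rewrite -Dp -mulrA ler_pM2l.
  split.
  - apply: (le_trans HA); have := ler_wpM2l maj IA.
    have := ler_wpM2l (ltW (al0 j)) (lerD DX Emu); lra.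
  - apply: (le_trans HX); have := ler_wpM2l cbj IX.
    have := ler_wpM2l (ltW (be0 j)) (lerD DZ Ep); lra.
  apply: (le_trans HZ); have := ler_wpM2l cbj IZ.
  have := ler_wpM2l (ltW (be0 j)) Eq; lra.
(* Boundedness turns the relative error into the absolute null sequence [eb], and each recursion
   becomes scalar. *)
pose eb k := eps k * ((2 + p) * B).
have eb_cvg : eb @ \oo --> 0.
  by rewrite -[X in _ --> X](mul0r ((2 + p) * B)); exact: cvgMl.
have eb_ge k : (N <= k)%N -> eps k * (1 + A k + X k) <= eb k.
  move=> /bounded[IA IX _]; rewrite /eb ler_wpM2l// mulrDl; lra.
have Z_cvg : Z @ \oo --> 0.
  apply: (recursion_cvg0 Z beta eb c) => //; first exact: nearW.
  exists N => // k /= Nk; have [_ _ [HZ _ _]] := HN _ Nk; apply: (le_trans HZ).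
  by rewrite lerD2l ler_wpM2l ?eb_ge// ltW.
have X_cvg : X @ \oo --> 0.
  apply: (recursion_cvg0 X beta (fun k => D * Z k + eb k) c) => //.
  - exact: nearW.
  - rewrite -[X in _ --> X](_ : D * 0 + 0 = 0); last by rewrite mulr0 addr0.
    by apply: cvgD => //; exact: cvgMr.
  - exists N => // k /= Nk; have [_ _ [_ HX _]] := HN _ Nk; apply: (le_trans HX).
    by rewrite lerD2l ler_wpM2l ?lerD2l ?eb_ge// ltW.
split => //; apply: (recursion_cvg0 A alpha (fun k => D * X k + eb k) mu) => //.
- rewrite -[X in _ --> X](_ : D * 0 + 0 = 0); last by rewrite mulr0 addr0.
  by apply: cvgD => //; exact: cvgMr.
- exists N => // k /= Nk; have [_ _ [_ _ HA]] := HN _ Nk; apply: (le_trans HA).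
  by rewrite lerD2l ler_wpM2l ?lerD2l ?eb_ge// ltW.
Unshelve. all: by end_near.
Qed.

(** * A norm contracted by the weight matrix *)

Definition vnorm {R : realType} {n : nat} (v : 'cV[R]_n) : R :=
  \big[Num.max/0]_i `|v i 0|.

Lemma vnorm_ge {R : realType} {n : nat} (v : 'cV[R]_n) i : `|v i 0| <= vnorm v.
Proof. exact: (le_bigmax _ (fun i => `|v i 0|)). Qed.

Lemma vnorm_ge0 {R : realType} {n : nat} (v : 'cV[R]_n) : 0 <= vnorm v.
Proof. by rewrite /vnorm; elim/big_ind: _ => // x y x0 y0; rewrite le_max x0. Qed.

Lemma vnorm_le {R : realType} {n : nat} (v : 'cV[R]_n) (B : R) :
  0 <= B -> (forall i, `|v i 0| <= B) -> vnorm v <= B.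
Proof. by move=> B0 H; apply: bigmax_le. Qed.

Lemma vnormD {R : realType} {n : nat} (u v : 'cV[R]_n) :
  vnorm (u + v) <= vnorm u + vnorm v.
Proof.
apply: vnorm_le => [|i]; first by rewrite addr_ge0 ?vnorm_ge0.
by rewrite mxE (le_trans (ler_normD _ _))// lerD ?vnorm_ge.
Qed.

Lemma vnormZ {R : realType} {n : nat} (a : R) (v : 'cV[R]_n) :
  vnorm (a *: v) <= `|a| * vnorm v.
Proof.
apply: vnorm_le => [|i]; first by rewrite mulr_ge0 ?vnorm_ge0.
by rewrite mxE normrM ler_wpM2l ?vnorm_ge.
Qed.

Lemma vnormN {R : realType} {n : nat} (v : 'cV[R]_n) : vnorm (- v) = vnorm v.
Proof. by rewrite /vnorm; under eq_bigr do rewrite mxE normrN. Qed.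

Lemma vnormB {R : realType} {n : nat} (u v : 'cV[R]_n) :
  vnorm (u - v) <= vnorm u + vnorm v.
Proof. by rewrite -[vnorm v]vnormN vnormD. Qed.

Lemma vnorm_cvg0 {R : realType} {n : nat} (u : nat -> 'cV[R]_n) :
  (forall i, (fun k => u k i 0) @ \oo --> 0) -> (fun k => vnorm (u k)) @ \oo --> 0.
Proof.
move=> H; apply/cvgrPdist_le => eta eta0.
have : \forall k \near \oo, forall i, `|u k i 0| <= eta.
  apply: filter_forall => i; move/cvgrPdist_le : (H i) => /(_ _ eta0).
  by apply: filterS => k; rewrite sub0r normrN.
apply: filterS => k Hk; rewrite sub0r normrN ger0_norm ?vnorm_ge0//.
by apply: vnorm_le => //; exact: ltW.
Qed.

Lemma substochastic_vnorm {R : realType} {n : nat} (A : 'M[R]_n) (a : R)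
    (v : 'cV[R]_n) :
  (forall i j, 0 <= A i j) -> (forall i, \sum_j A i j = a) -> 0 <= a ->
  vnorm (A *m v) <= a * vnorm v.
Proof.
move=> A0 A1 a0; apply: vnorm_le => [|i]; first by rewrite mulr_ge0 ?vnorm_ge0.
rewrite mxE (le_trans (ler_norm_sum _ _ _))// -(A1 i) mulr_suml.
by apply: ler_sum => j _; rewrite normrM ger0_norm// ler_wpM2l ?vnorm_ge.
Qed.

Set Implicit Arguments.
(** Since [W] fixes the constant vectors, contraction is asked only on the kernel of [r^T]. A single
    application of [W] need not contract [vnorm] there, hence an equivalent norm [N]. *)
Record contracting_norm {R : realType} {n : nat} (W : 'M[R]_n) (r : 'cV[R]_n)
    (c C : R) (N : 'cV[R]_n -> R) : Prop := ContractingNorm {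
  cnorm_c : 0 < c <= 1 ;
  cnorm_C : 0 < C ;
  cnormD : forall u v, N (u + v) <= N u + N v ;
  cnormZ : forall a v, N (a *: v) <= `|a| * N v ;
  cnorm_ge : forall v, vnorm v <= N v ;
  cnorm_le : forall v, N v <= C * vnorm v ;
  cnorm_contract : forall v, r^T *m v = 0 -> N (W *m v) <= (1 - c) * N v }.
Unset Implicit Arguments.

Section ContractingNorm.
Context {R : realType} {n : nat}.
Variables (adj : rel 'I_n) (W : 'M[R]_n) (r : 'cV[R]_n).
Hypotheses (hW : network_matrix adj W) (hr : left_perron_vector W r).

Lemma expmx_stochastic m :
  (forall i j, 0 <= (W ^+ m) i j) /\ (forall i, \sum_j (W ^+ m) i j = 1).
Proof.
have W1 i : \sum_j W i j = 1.
  have := congr1 (fun v : 'cV[R]_n => v i 0) (network_row_stochastic hW).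
  by rewrite !mxE => <-; apply: eq_bigr => j _; rewrite mxE mulr1.
elim: m => [|m [IH0 IH1]].
  split=> [i j|i]; first by rewrite expr0 mxE ler0n.
  rewrite expr0 (bigD1 i)//= mxE eqxx big1 ?addr0// => j ji.
  by rewrite mxE eq_sym (negbTE ji).
split=> [i j|i]; rewrite exprS.
  by rewrite mxE sumr_ge0// => k _; rewrite mulr_ge0// (network_ge0 hW).
under eq_bigr do rewrite mxE.
rewrite exchange_big/= -[RHS](W1 i); apply: eq_bigr => k _.
by rewrite -mulr_sumr IH1 mulr1.
Qed.

(** Doeblin's argument: on the kernel of [r^T], subtracting [th] times the rank-one matrix with rows
    [r^T] does not change the action of [W ^+ m]. The entries stay nonnegative and the row sums drop
    to [1 - th]. *)
Lemma primitive_contraction : exists m (th : R), [/\ (0 < m)%N, 0 < th, th <= 1 &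
  forall v, r^T *m v = 0 -> vnorm (W ^+ m *m v) <= (1 - th) * vnorm v].
Proof.
have [m m0 Wm] := network_primitive hW; exists m.
pose th : R := \big[Num.min/1]_i \big[Num.min/1]_j (W ^+ m) i j.
have th0 : 0 < th by apply: lt_bigmin => // i _; apply: lt_bigmin.
have th1 : th <= 1 by exact: bigmin_le_id.
have thW i j : th <= (W ^+ m) i j.
  apply: le_trans (bigmin_le _ i _) _; exact: (bigmin_le _ j).
exists th; split => // v rv.
have [W0 W1] := expmx_stochastic m.
have r1 i : r i 0 <= 1.
  rewrite -(perron_sum1 hr) (bigD1 i)//= lerDl sumr_ge0// => j _.
  exact/ltW/(perron_gt0 hr).
pose A : 'M[R]_n := W ^+ m - th *: (const_mx 1 *m r^T).
have AE i j : A i j = (W ^+ m) i j - th * r j 0.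
  by rewrite !mxE big_ord_recl big_ord0 addr0 !mxE mul1r.
have -> : W ^+ m *m v = A *m v.
  by rewrite /A mulmxBl -scalemxAl -mulmxA rv mulmx0 scaler0 subr0.
apply: substochastic_vnorm; last by rewrite subr_ge0.
  move=> i j; rewrite AE subr_ge0; apply: le_trans (thW i j).
  by rewrite ler_piMr// ltW.
move=> i; under eq_bigr do rewrite AE.
by rewrite sumrB W1 -mulr_sumr (perron_sum1 hr) mulr1.
Qed.


Lemma contracting_norm_exists : exists c C N, contracting_norm W r c C N.
Proof.
have [m [th [m0 th0 th1 Wm]]] := primitive_contraction.
have mR : 0 < m%:R :> R by rewrite ltr0n.
pose t := th / (2 * m%:R).
have t0 : 0 < t by rewrite divr_gt0// mulr_gt0.
have mt : m%:R * t = th / 2 by rewrite /t; field; rewrite gt_eqF.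
have m1 : 1 <= m%:R :> R by rewrite ler1n.
have t12 : t <= th / 2 by rewrite -mt ler_peMl// ltW.
(* Applying [W] shifts the sum defining [N], which lowers the weight of every
   term by [t]; the contraction of [W ^+ m] pays for the new last term. *)
pose w j : R := 1 + j%:R * t.
have w1 j : 1 <= w j by rewrite /w lerDl mulr_ge0 ?ler0n ?ltW.
have w0 j : 0 <= w j by rewrite (le_trans _ (w1 j)).
pose a (v : 'cV[R]_n) j := vnorm (W ^+ j *m v).
have a0 v j : 0 <= a v j by exact: vnorm_ge0.
pose N v := \sum_(0 <= j < m) w j * a v j.
have a_le v j : a v j <= vnorm v.
  have [W0 W1] := expmx_stochastic j.
  by rewrite /a (le_trans (substochastic_vnorm _ _ v W0 W1 ler01))// mul1r.
pose C := m%:R * w m.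
have wm j : (j < m)%N -> w j <= w m.
  by move=> jm; rewrite lerD2l ler_wpM2r ?ler_nat 1?ltnW// ltW.
have wm0 : 0 < w m by rewrite (lt_le_trans _ (w1 m)).
(* The gain of one step is [t] times the sum of the [a v j], and that sum is at least
   [N v / w m]. *)
exists (t / w m), C, N; split.
- rewrite divr_gt0//= ler_pdivrMr// mul1r (le_trans _ (w1 m))// (le_trans t12)//.
  lra.
- by rewrite mulr_gt0.
- move=> u v; rewrite /N -big_split/=; apply: ler_sum => j _.
  by rewrite -mulrDr ler_wpM2l// /a mulmxDr vnormD.
- move=> b v; rewrite /N mulr_sumr; apply: ler_sum => j _.
  by rewrite mulrCA ler_wpM2l// /a -scalemxAr vnormZ.
- move=> v; rewrite /N big_ltn// /a expr0 mul1mx /w mul0r addr0 mul1r lerDl.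
  by apply: sumr_ge0 => j _; rewrite mulr_ge0 ?vnorm_ge0//; exact: w0.
- move=> v; rewrite /N /C -mulrA mulr_natl -[X in _ *+ X]subn0 -sumr_const_nat.
  rewrite !big_nat; apply: ler_sum => j /andP[_ jm].
  by apply: ler_pM => //; exact: wm.
move=> v rv.
have NW : N (W *m v) = \sum_(0 <= j < m) w j * a v j.+1.
  by apply: eq_bigr => j _; rewrite /a exprSr mulmxA.
have aS : \sum_(0 <= j < m) w j * a v j.+1 + t * \sum_(0 <= j < m) a v j.+1 =
    N v - a v 0%N + w m * a v m.
  have -> : N v - a v 0%N + w m * a v m = \sum_(1 <= j < m.+1) w j * a v j.
    rewrite big_nat_recr//= /N [in LHS]big_ltn// {1}/w mul0r addr0 mul1r; ring.
  rewrite big_add1 /= mulr_sumr -big_split/=; apply: eq_bigr => j _.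
  by rewrite /w -natr1; ring.
have am : a v m <= (1 - th) * a v 0%N.
  by rewrite {2}/a expr0 mul1mx; exact: Wm.
have sum_a : \sum_(0 <= j < m) a v j <= \sum_(0 <= j < m) a v j.+1 + a v 0%N.
  rewrite [leLHS]big_ltn// addrC lerD2r.
  rewrite -[m in leRHS]prednK//; rewrite -{1}(prednK m0) big_add1 /=.
  by rewrite [leRHS]big_nat_recr//= lerDl.
have Nle : N v <= w m * \sum_(0 <= j < m) a v j.
  rewrite /N mulr_sumr !big_nat; apply: ler_sum => j /andP[_ jm].
  by rewrite ler_wpM2r// wm.
(* The weights grow in total by only [th / 2], so half of the contraction of [W ^+ m] survives; the
   surviving half pays for the index shift in the sum of the [a v j], as [t <= th / 2]. *)
have wam : w m * a v m <= (1 - th / 2) * a v 0%N.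
  apply: (le_trans (ler_wpM2l (ltW wm0) am)); rewrite mulrA ler_wpM2r//.
  by rewrite /w mt; have := sqr_ge0 th; nra.
have : t / w m * N v <= t * \sum_(0 <= j < m) a v j.
  by rewrite mulrAC -mulrA ler_wpM2l ?(ltW t0)// ler_pdivrMr// mulrC.
have : t * \sum_(0 <= j < m) a v j <= t * (\sum_(0 <= j < m) a v j.+1 + a v 0%N).
  by rewrite ler_wpM2l ?(ltW t0).
have ta0 : t * a v 0%N <= th / 2 * a v 0%N by rewrite ler_wpM2r.
rewrite NW; move: aS wam ta0; set S1 := \sum_(_ <= _ < _) _ * _; lra.
Qed.

End ContractingNorm.

(** * Strongly convex averages *)

Lemma derivable_difference_quotient {R : realType} (f : R -> R) (y eps : R) :
  derivable f y 1 -> 0 < eps -> exists2 delta, 0 < delta &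
  forall s, 0 < `|s| < delta -> `|f (y + s) - f y - s * derive1 f y| <= eps * `|s|.
Proof.
move=> df eps0; have : (h^-1 *: (f (h *: 1 + y) - f y) @[h --> 0^'] --> derive1 f y).
  by rewrite derive1E; exact: df.
move=> /cvgrPdist_lt /(_ _ eps0) [delta /= delta0 H]; exists delta => // s.
move=> /andP[s0 sd]; have s_neq0 : s != 0 by rewrite -normr_gt0.
have /= := H s; rewrite sub0r normrN => /(_ sd s_neq0) /ltW.
rewrite -(@ler_pM2r _ `|s|)// -normrM; congr (_ <= _).
rewrite -normrN; congr `|_|; rewrite [s *: 1]mulr1 [s + y]addrC -[_ *: _]/(_ * _).
by field.
Qed.

Section StronglyConvex.
Context {R : realType}.
Variables (mu L : R) (f : R -> R).
Hypotheses (mu0 : 0 < mu) (f_convex : strongly_convex mu f) (f_smooth : smooth L f).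

(** The strong convexity inequality at [y + t * h], divided by [t], gives this as [t] tends to 0;
    the limit is replaced by an explicit small [t] and an arbitrary loss [eta]. *)
Lemma strongly_convex_gradient (y h : R) :
  h * derive1 f y + mu / 2 * h ^+ 2 <= f (y + h) - f y.
Proof.
have [->|h0] := eqVneq h 0; first by rewrite addr0 subrr expr0n/= mul0r mulr0 addr0.
apply/ler_addgt0Pr => eta eta0.
have nh0 : 0 < `|h| by rewrite normr_gt0.
pose K := `|h| + mu / 2 * h ^+ 2.
have K0 : 0 < K by rewrite ltr_pwDl// mulr_ge0 ?sqr_ge0// divr_ge0// ltW.
pose eps := eta / K; have eps0 : 0 < eps by rewrite divr_gt0.
have [delta delta0 H] := derivable_difference_quotient f y eps (f_smooth.1 y) eps0.
(* The three caps serve convexity, the quadratic remainder [t * (mu / 2 * h ^+ 2)], and the range of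
   the difference quotient. The total loss is then at most [eps * K = eta]. *)
pose t := Num.min 1 (Num.min eps (delta / (2 * `|h|))).
have t0 : 0 < t by rewrite /t !lt_min ltr01 eps0 divr_gt0// mulr_gt0.
have t1 : t <= 1 by rewrite /t ge_min lexx.
have te : t <= eps by rewrite /t !ge_min lexx orbT.
have td : t <= delta / (2 * `|h|) by rewrite /t !ge_min lexx !orbT.
have : 0 < `|t * h| < delta.
  rewrite normrM (gtr0_norm t0) mulr_gt0//=.
  apply: (@le_lt_trans _ _ (delta / (2 * `|h|) * `|h|)); first by rewrite ler_wpM2r.
  have -> : delta / (2 * `|h|) * `|h| = delta / 2 by field; rewrite gt_eqF.
  by rewrite ltr_pdivrMr// ltr_pMr// ltr1n.
move=> /H; rewrite normrM (gtr0_norm t0) => /ler_normlP[Hd _].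
have t01 : 0 <= t <= 1 by rewrite (ltW t0).
have := f_convex (y + h) y t t01.
have -> : t * (y + h) + (1 - t) * y = y + t * h by ring.
have -> : y + h - y = h by ring.
move=> Hc.
have : t * (h * derive1 f y + mu / 2 * h ^+ 2) <=
       t * (f (y + h) - f y + (eps * `|h| + t * (mu / 2 * h ^+ 2))).
  by move: Hd Hc; lra.
rewrite ler_pM2l// => /le_trans; apply; rewrite lerD2l.
have -> : eta = eps * K by rewrite /eps divfK// gt_eqF.
by rewrite /K mulrDr lerD2l ler_wpM2r// mulr_ge0 ?sqr_ge0// divr_ge0// ltW.
Qed.

Lemma smooth_gradient_le x y : `|derive1 f x - derive1 f y| <= L * `|x - y|.
Proof. by have := f_smooth.2 (x, y); apply. Qed.

End StronglyConvex.

Section AvgGradient.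
Context {R : realType} {n : nat}.
Variables (f : 'I_n -> R -> R) (mu L xstar : R) (i0 : 'I_n).
Hypotheses (mu0 : 0 < mu) (L0 : 0 < L).
Hypothesis f_convex : forall i, strongly_convex mu (f i).
Hypothesis f_smooth : forall i, smooth L (f i).
Hypothesis xstar_min : forall x, avg_objective f xstar <= avg_objective f x.

Definition avg_gradient (g : 'I_n -> R -> R) (x : R) : R :=
  n%:R^-1 * \sum_i derive1 (g i) x.

Let n0 : 0 < n%:R :> R.
Proof. by rewrite ltr0n; case: n i0 => // -[]. Qed.

Let avg_cst (c : R) : n%:R^-1 * \sum_(i < n) c = c.
Proof.
by rewrite sumr_const card_ord -[c *+ n]mulr_natl mulrA mulVf ?mul1r// gt_eqF.
Qed.

Lemma avg_strongly_convex_gradient y h :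
  h * avg_gradient f y + mu / 2 * h ^+ 2 <=
  avg_objective f (y + h) - avg_objective f y.
Proof.
rewrite /avg_gradient /avg_objective -mulrBr mulrCA -[X in _ + X]avg_cst -mulrDr.
rewrite ler_pM2l ?invr_gt0// mulr_sumr -sumrB -big_split/=; apply: ler_sum => i _.
exact: (strongly_convex_gradient mu L).
Qed.

Lemma avg_gradient_lipschitz x y :
  `|avg_gradient f x - avg_gradient f y| <= L * `|x - y|.
Proof.
rewrite /avg_gradient -mulrBr normrM gtr0_norm ?invr_gt0// -[leRHS]avg_cst.
rewrite ler_pM2l ?invr_gt0// -sumrB (le_trans (ler_norm_sum _ _ _))//.
by apply: ler_sum => i _; exact: smooth_gradient_le.
Qed.

(** Tested at [xstar + h] with [h = - G / (2 * L)]: convexity and minimality make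
    [h * avg_gradient f (xstar + h)] nonnegative, while the Lipschitz bound makes it at most
    [- L * h ^+ 2]. So [h] is 0. *)
Lemma avg_gradient_xstar : avg_gradient f xstar = 0.
Proof.
set G := avg_gradient f xstar; pose h := - G / (2 * L).
have := avg_strongly_convex_gradient (xstar + h) (- h).
rewrite addrK; have := xstar_min (xstar + h).
have := avg_gradient_lipschitz (xstar + h) xstar.
rewrite -/G (_ : xstar + h - xstar = h); last by ring.
move=> lip mn cvx; have cvx' : h * avg_gradient f (xstar + h) >= 0.
  move: cvx mn; have : 0 <= mu / 2 * (- h) ^+ 2.
    by rewrite mulr_ge0 ?sqr_ge0// divr_ge0// ltW.
  lra.
have : h * (avg_gradient f (xstar + h) - G) <= L * h ^+ 2.
  apply: (le_trans (ler_norm _)); rewrite normrM.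
  apply: (le_trans (ler_wpM2l (normr_ge0 h) lip)).
  by rewrite mulrCA -expr2 real_normK ?num_real.
have hE : G = - (2 * L) * h by rewrite /h; field; rewrite gt_eqF.
have hG : h * G = - (2 * L) * h ^+ 2 by rewrite {1}hE; ring.
rewrite mulrBr hG => H.
have : L * h ^+ 2 <= 0 by move: H cvx'; lra.
rewrite pmulr_rle0// => h2; have /eqP : h ^+ 2 == 0 by rewrite eq_le h2 sqr_ge0.
by move=> /eqP; rewrite sqrf_eq0 => /eqP h0; rewrite hE h0 mulr0.
Qed.

Lemma avg_gradient_monotone x :
  mu * (x - xstar) ^+ 2 <= avg_gradient f x * (x - xstar).
Proof.
have := avg_strongly_convex_gradient xstar (x - xstar).
have := avg_strongly_convex_gradient x (xstar - x).
rewrite avg_gradient_xstar (_ : xstar + (x - xstar) = x); last by ring.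
rewrite (_ : x + (xstar - x) = xstar); last by ring.
lra.
Qed.

(** For [u > 0] the gradient lies between [mu * u] and [L * u], so a step with [a * L <= 1] cannot
    overshoot the minimizer, and the lower bound gives the factor. The other sign follows by
    reflection. *)
Lemma avg_gradient_step a x : 0 <= a -> a * L <= 1 ->
  `|x - xstar - a * avg_gradient f x| <= (1 - a * mu) * `|x - xstar|.
Proof.
move=> a0 aL; have := avg_gradient_lipschitz x xstar.
rewrite avg_gradient_xstar subr0; have := avg_gradient_monotone x.
set u := x - xstar; set g := avg_gradient f x => gu gL.
wlog u0 : u g gu gL / 0 <= u.
  move=> H; have [|u0] := leP 0 u; first exact: H.
  have -> : u - a * g = - (- u - a * - g) by ring.
  rewrite normrN -[in leRHS]normrN; apply: H; rewrite ?sqrrN ?mulrNN ?normrN//.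
  by rewrite oppr_ge0 ltW.
have [u_0|/eqP u_neq0] := eqVneq u 0.
  by move: gL; rewrite u_0 normr0 mulr0 normr_le0 => /eqP ->; rewrite mulr0 subr0 normr0 mulr0.
have {}u0 : 0 < u by rewrite lt_neqAle eq_sym u0 andbT; apply/eqP.
move: gL; rewrite (gtr0_norm u0) => /ler_normlP[_ gL].
have mug : mu * u <= g by rewrite -(ler_pM2r u0) -mulrA -expr2.
have : a * g <= u by apply: le_trans (ler_wpM2l a0 gL) _; rewrite mulrA ler_piMl// ltW.
have : a * (mu * u) <= a * g by rewrite ler_wpM2l.
move=> H1 H2; rewrite ger0_norm ?subr_ge0//; lra.
Qed.

Lemma avg_objective_gap x :
  `|avg_objective f x - avg_objective f xstar| <= L * `|x - xstar| ^+ 2.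
Proof.
rewrite ger0_norm ?subr_ge0//.
have := avg_strongly_convex_gradient x (xstar - x).
rewrite (_ : x + (xstar - x) = xstar) => [H|]; last by ring.
have : 0 <= mu / 2 * (xstar - x) ^+ 2 by rewrite mulr_ge0 ?sqr_ge0// divr_ge0// ltW.
have : (x - xstar) * avg_gradient f x <= L * `|x - xstar| ^+ 2.
  apply: (le_trans (ler_norm _)); rewrite normrM.
  have := avg_gradient_lipschitz x xstar; rewrite avg_gradient_xstar subr0 => lip.
  by apply: (le_trans (ler_wpM2l (normr_ge0 _) lip)); rewrite mulrCA -expr2.
move: H; lra.
Qed.

End AvgGradient.

(** * Consensus and optimization *)

Lemma sup_ratio_ge {R : realType} (gamma lambda : nat -> R) (k l : nat) :
  (l <= k)%N -> gamma l / lambda l <= sup_ratio gamma lambda k.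
Proof.
move=> lk; apply: ub_le_sup; last by exists l.
(* [sup] is meaningful only on a bounded set; the sum of the moduli is a crude upper bound. *)
exists (\sum_(0 <= j < k.+1) `|gamma j / lambda j|) => _ [j /= jk <-].
have mj : j \in index_iota 0 k.+1 by rewrite mem_index_iota.
rewrite (le_trans (ler_norm _))// (bigD1_seq j mj (iota_uniq _ _))/=.
by rewrite lerDl sumr_ge0.
Qed.

Lemma sup_ratio_mono {R : realType} (gamma lambda : nat -> R) (k : nat) :
  sup_ratio gamma lambda k <= sup_ratio gamma lambda k.+1.
Proof.
apply: ge_sup; first by exists (gamma 0%N / lambda 0%N), 0%N.
by move=> _ [l /= lk <-]; apply: sup_ratio_ge; rewrite leqW.
Qed.

Section Network.
Context {R : realType} {n : nat}.
Variables (adj : rel 'I_n) (W : 'M[R]_n) (r : 'cV[R]_n) (c C : R) (N : 'cV[R]_n -> R).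
Hypotheses (hW : network_matrix adj W) (hr : left_perron_vector W r).
Hypothesis hN : contracting_norm W r c C N.
Let W1 := network_row_stochastic hW.

Definition wavg (v : 'cV[R]_n) : R := (r^T *m v) 0 0.
(** The projection along the constant vectors onto the kernel of [r^T], the space where [N]
    contracts. *)
Definition dev (v : 'cV[R]_n) : 'cV[R]_n := v - wavg v *: const_mx 1.

Lemma wavgE v : wavg v = \sum_i r i 0 * v i 0.
Proof. by rewrite /wavg mxE; apply: eq_bigr => i _; rewrite mxE. Qed.

Lemma wavgD u v : wavg (u + v) = wavg u + wavg v.
Proof. by rewrite /wavg mulmxDr mxE. Qed.

Lemma wavgZ a v : wavg (a *: v) = a * wavg v.
Proof. by rewrite /wavg -scalemxAr mxE. Qed.

Lemma wavgN v : wavg (- v) = - wavg v.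
Proof. by rewrite /wavg mulmxN mxE. Qed.

Lemma wavgW v : wavg (W *m v) = wavg v.
Proof. by rewrite /wavg mulmxA (perron_fixed hr). Qed.

Lemma wavg1 : wavg (const_mx 1) = 1.
Proof.
by rewrite wavgE -[RHS](perron_sum1 hr); apply: eq_bigr => i _; rewrite mxE mulr1.
Qed.

Lemma wavg_dev v : wavg (dev v) = 0.
Proof. by rewrite /dev wavgD wavgN wavgZ wavg1 mulr1 subrr. Qed.

Lemma devD u v : dev (u + v) = dev u + dev v.
Proof. by rewrite /dev wavgD scalerDl opprD addrACA. Qed.

Lemma devZ a v : dev (a *: v) = a *: dev v.
Proof. by rewrite /dev wavgZ scalerBr scalerA. Qed.

Lemma devN v : dev (- v) = - dev v.
Proof. by rewrite -scaleN1r devZ scaleN1r. Qed.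

Lemma devW v : dev (W *m v) = W *m dev v.
Proof. by rewrite /dev wavgW mulmxBr -scalemxAr W1. Qed.

Lemma wavg_le v : `|wavg v| <= vnorm v.
Proof.
rewrite wavgE (le_trans (ler_norm_sum _ _ _))//.
rewrite -[leRHS]mul1r -(perron_sum1 hr) mulr_suml; apply: ler_sum => i _.
by rewrite normrM gtr0_norm ?(perron_gt0 hr)// ler_wpM2l ?vnorm_ge// ltW// (perron_gt0 hr).
Qed.

Lemma dev_le v : vnorm (dev v) <= 2 * vnorm v.
Proof.
apply: vnorm_le => [|i]; first by rewrite mulr_ge0 ?vnorm_ge0.
rewrite !mxE mulr1 (le_trans (ler_normB _ _))//.
by have := vnorm_ge v i; have := wavg_le v; lra.
Qed.

Lemma cnorm_ge0 v : 0 <= N v.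
Proof. exact: le_trans (vnorm_ge0 v) (cnorm_ge hN v). Qed.

Lemma cnorm_dev v : N (dev v) <= 2 * C * vnorm v.
Proof.
apply: le_trans (cnorm_le hN _) _; rewrite [2 * C]mulrC -mulrA.
by rewrite ler_pM2l ?(cnorm_C hN)// dev_le.
Qed.

Lemma cnorm_step b v : 0 <= b <= 1 -> wavg v = 0 ->
  N ((1 - b) *: v + b *: (W *m v)) <= (1 - c * b) * N v.
Proof.
move=> /andP[b0 b1] v0; apply: le_trans (cnormD hN _ _) _.
apply: (le_trans (lerD (cnormZ hN _ _) (cnormZ hN _ _))).
rewrite (ger0_norm b0) ger0_norm ?subr_ge0//.
have rv : r^T *m v = 0 by apply/matrixP => i j; rewrite !ord1 -/(wavg v) v0 mxE.
have := ler_wpM2l b0 (cnorm_contract hN rv); lra.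
Qed.

(** * Estimation of the left Perron vector *)

Section EigenvectorEstimation.
Variables (lambda gamma : nat -> R) (u e : nat -> 'cV[R]_n) (d : 'cV[R]_n) (s : R).
Hypothesis s0 : 0 <= s.
Hypothesis gamma_gt0 : forall k, 0 < gamma k.
Hypothesis lambda_range : forall k, 0 < lambda k <= 1.
Hypothesis ratio_lim :
  (fun k => (psum gamma k)^-1 * sup_ratio gamma lambda k) @ \oo --> 0.
Hypothesis Lambda_Gamma : (fun k => psum lambda k / psum gamma k) @ \oo --> 0.
Hypothesis Gamma_oo : (fun k => (psum gamma k)^-1) @ \oo --> 0.
Hypothesis e_le : forall k, vnorm (e k) <= s.
Hypothesis uS : forall k, u k.+1 =
  (1 - lambda k) *: u k + lambda k *: (W *m u k + e k) + gamma k *: d.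

(** Mixing preserves the Perron average, which therefore only accumulates the inputs. Both partial
    sums include index [k], matching [u k.+1]. *)
Lemma eigenvector_avg k :
  `|wavg (u k.+1) - wavg (u 0%N) - psum gamma k * wavg d| <= s * psum lambda k.
Proof.
have avgS m : wavg (u m.+1) = wavg (u m) + lambda m * wavg (e m) + gamma m * wavg d.
  by rewrite uS !wavgD !wavgZ wavgD wavgW; ring.
have eb m : `|lambda m * wavg (e m)| <= s * lambda m.
  have /andP[l0 _] := lambda_range m.
  by rewrite normrM gtr0_norm// mulrC ler_pM2r// (le_trans (wavg_le _)).
elim: k => [|k IH]; rewrite avgS /psum.
  rewrite !big_nat1 (_ : _ - _ - _ = lambda 0%N * wavg (e 0%N)) ?eb//; ring.
rewrite !(big_nat_recr k.+1)//=; rewrite /psum in IH.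
set A := \sum_(_ <= _ < _) gamma _ in IH *; set B := \sum_(_ <= _ < _) lambda _ in IH *.
rewrite (_ : _ - _ - _ = (wavg (u k.+1) - wavg (u 0%N) - A * wavg d) +
   lambda k.+1 * wavg (e k.+1)); last by ring.
by rewrite (le_trans (ler_normD _ _))// mulrDr lerD.
Qed.

(** While [gamma k <= lambda k * G], the input is at most [lambda k * (1 + G) * K] against a
    contraction at rate [c * lambda k]. [B] is the equilibrium [K / c] plus the initial
    disagreement, and the running supremum never decreases. *)
Lemma eigenvector_dev : exists2 B, 0 <= B & forall k,
  N (dev (u k.+1)) <= B * (1 + sup_ratio gamma lambda k).
Proof.
have /andP[c0 c1] := cnorm_c hN.
pose K := 2 * C * (s + vnorm d).
have K0 : 0 <= K by rewrite !mulr_ge0 ?(ltW (cnorm_C hN))// addr_ge0// vnorm_ge0.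
pose B := K / c + N (dev (u 0%N)).
have B0 : 0 <= B by rewrite addr_ge0 ?cnorm_ge0// divr_ge0// ltW.
have KB : K <= c * B.
  by rewrite /B mulrDr mulrCA divff ?gt_eqF// mulr1 lerDl mulr_ge0 ?cnorm_ge0// ltW.
have G0 k : 0 <= sup_ratio gamma lambda k.
  apply: le_trans (sup_ratio_ge _ _ k k (leqnn k)).
  by have /andP[l0 _] := lambda_range k; rewrite divr_ge0 ?ltW.
have step k G : 0 <= G -> gamma k / lambda k <= G -> N (dev (u k)) <= B * (1 + G) ->
    N (dev (u k.+1)) <= B * (1 + G).
  move=> G_ge0 gG IH; have /andP[l0 l1] := lambda_range k.
  have gl : gamma k <= lambda k * G by rewrite mulrC -ler_pdivrMr.
  rewrite uS !devD !devZ devD devW.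
  rewrite [_ *: (W *m _ + _)]scalerDr addrA.
  set v := _ *: dev (u k) + _.
  have Nv : N v <= (1 - c * lambda k) * N (dev (u k)).
    by apply: cnorm_step; rewrite ?wavg_dev// (ltW l0).
  have N1 : N (lambda k *: dev (e k)) <= lambda k * (2 * C * s).
    apply: (le_trans (cnormZ hN _ _)); rewrite gtr0_norm// ler_pM2l//.
    apply: (le_trans (cnorm_dev _)); rewrite ler_pM2l//.
    by rewrite mulr_gt0// (cnorm_C hN).
  have N2 : N (gamma k *: dev d) <= lambda k * G * (2 * C * vnorm d).
    apply: (le_trans (cnormZ hN _ _)); rewrite gtr0_norm//.
    by apply: ler_pM => //; rewrite ?cnorm_ge0 ?cnorm_dev// ltW.
  have NN := le_trans (cnormD hN _ _)
    (lerD (cnormD hN v (lambda k *: dev (e k))) (lexx (N (gamma k *: dev d)))).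
  apply: (le_trans NN).
  have H1 : (1 - c * lambda k) * N (dev (u k)) <= (1 - c * lambda k) * (B * (1 + G)).
    by rewrite ler_wpM2l// subr_ge0 mulr_ile1// ltW.
  have H2 : lambda k * (2 * C * s) + lambda k * G * (2 * C * vnorm d) <=
      lambda k * (1 + G) * K.
    have a0 : 0 <= lambda k * (2 * C * vnorm d).
      by rewrite !mulr_ge0 ?vnorm_ge0 ?(ltW (cnorm_C hN))// ltW.
    have b0 : 0 <= lambda k * G * (2 * C * s).
      by rewrite !mulr_ge0 ?(ltW (cnorm_C hN))// ltW.
    by rewrite /K; move: a0 b0; lra.
  have H3 : lambda k * (1 + G) * K <= lambda k * (1 + G) * (c * B).
    by rewrite ler_wpM2l// mulr_ge0 ?addr_ge0// ltW.
  move: Nv N1 N2 H1 H2 H3; lra.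
exists B => //; elim=> [|k IH]; apply: step; rewrite ?G0 ?sup_ratio_ge//.
  apply: (@le_trans _ _ B); first by rewrite lerDr divr_ge0// ltW.
  by rewrite ler_peMr// lerDl.
by apply: le_trans IH _; rewrite ler_wpM2l// lerD2l sup_ratio_mono.
Qed.

(** After division by [psum gamma k], the accumulated noise, the initial value and the disagreement
    vanish through [Lambda_Gamma], [Gamma_oo] and [ratio_lim]; the constant part of the disagreement
    bound joins the initial value. *)
Lemma eigenvector_estimate i :
  (fun k => u k.+1 i 0 / psum gamma k) @ \oo --> wavg d.
Proof.
have [B B0 HB] := eigenvector_dev.
have G0 k : 0 < psum gamma k.
  rewrite /psum big_nat_recr//= ltr_wpDl// sumr_ge0// => j _; exact/ltW.
pose h k := s * (psum lambda k / psum gamma k) +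
  (`|wavg (u 0%N)| + B) * (psum gamma k)^-1 +
  B * ((psum gamma k)^-1 * sup_ratio gamma lambda k).
have h_cvg : h @ \oo --> 0.
  rewrite -[X in _ --> X](_ : s * 0 + (`|wavg (u 0%N)| + B) * 0 + B * 0 = 0); last by ring.
  by apply: cvgD; [apply: cvgD|]; apply: cvgMr.
apply/cvgrPdist_le => eta eta0.
move/cvgrPdist_le : h_cvg => /(_ _ eta0); apply: filterS => k.
rewrite sub0r normrN => /(le_trans (ler_norm _)); apply: le_trans.
rewrite -normrN opprB.
have -> : u k.+1 i 0 / psum gamma k - wavg d =
   (dev (u k.+1) i 0 + (wavg (u k.+1) - wavg (u 0%N) - psum gamma k * wavg d) +
     wavg (u 0%N)) / psum gamma k.
  by rewrite !mxE; field; rewrite gt_eqF.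
rewrite normrM normfV (gtr0_norm (G0 k)) ler_pdivrMr//.
have -> : h k * psum gamma k = s * psum lambda k + (`|wavg (u 0%N)| + B) +
   B * sup_ratio gamma lambda k by rewrite /h; field; rewrite gt_eqF.
have := HB k; have := eigenvector_avg k.
have := le_trans (vnorm_ge (dev (u k.+1)) i) (cnorm_ge hN _).
set a := dev _ i 0; set b := _ - _ - _.
have := ler_normD (a + b) (wavg (u 0%N)); have := ler_normD a b; lra.
Qed.

End EigenvectorEstimation.

(** * Joint recursion of the consensus and optimality errors *)

Section Optimization.
Variables (f : 'I_n -> R -> R) (mu L xstar : R) (i0 : 'I_n).
Hypotheses (mu0 : 0 < mu) (L0 : 0 < L).
Hypothesis f_convex : forall i, strongly_convex mu (f i).
Hypothesis f_smooth : forall i, smooth L (f i).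
Hypothesis xstar_min : forall x, avg_objective f xstar <= avg_objective f x.
Variables (alpha beta : nat -> R) (kappa : nat -> 'I_n -> R).
Variables (x z ex ez Tx Tz : nat -> 'cV[R]_n).
Hypothesis alpha_gt0 : forall k, 0 < alpha k.
Hypothesis beta_range : forall k, 0 < beta k <= 1.
Hypothesis alpha_div : forall N B, exists m, B <= \sum_(N <= k < m) alpha k.
Hypothesis beta_div : forall N B, exists m, B <= \sum_(N <= k < m) beta k.
Hypothesis alpha_beta : (fun k => alpha k / beta k) @ \oo --> 0.
Hypothesis kappa_cvg : forall i,
  (fun k => kappa k i) @ \oo --> (n%:R * r i 0)^-1.
(* [Tx k] and [Tz k] are the tails of the noise series, so that adding them to
   the iterates removes the noise up to terms of order [beta k] times a tail. *)
Hypothesis TxS : forall k, Tx k = Tx k.+1 + beta k *: ex k.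
Hypothesis TzS : forall k, Tz k = Tz k.+1 + beta k *: ez k.
Hypothesis Tx_cvg : (fun k => vnorm (Tx k)) @ \oo --> 0.
Hypothesis Tz_cvg : (fun k => vnorm (Tz k)) @ \oo --> 0.
Let g k : 'cV[R]_n := \col_i (kappa k i * derive1 (f i) (x k i 0)).
Hypothesis zS : forall k, z k.+1 =
  (1 - beta k) *: z k + beta k *: (W *m z k + ez k) + alpha k *: g k.
Hypothesis xS : forall k, x k.+1 =
  (1 - beta k) *: x k + beta k *: (W *m x k + ex k) - (z k.+1 - z k).

Let tau k := Tx k - Tz k.
Let x' k := x k + tau k.
Let z' k := z k + Tz k.
Let vT k := vnorm (Tx k) + vnorm (Tz k).
(** Averaging weights the gradient of agent [i] by [r i 0 * kappa k i]; [delta] measures how far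
    these weights are from uniform. *)
Let delta k := vnorm (\col_i (r i 0 * kappa k i - n%:R^-1)).
Let A k := `|wavg (x' k) - xstar|.
Let X k := N (dev (x' k)).
Let Z k := N (dev (z' k)).
Let M := \sum_i `|derive1 (f i) xstar|.
(** A bound for every [kappa k i] once it is within 1 of its limit. *)
Let K0 := 1 + \sum_i `|(n%:R * r i 0)^-1|.
Let K := K0 * (M + L).
(* [K] bounds the gradient terms; [D] dominates the constants of the three
   recursions. *)
Let D := 8 * C + 2 + 2 * C * K + K + n%:R * (M + L).
Let eps k := D * (vT k + alpha k / beta k + delta k).

Let z'S k : z' k.+1 = (1 - beta k) *: z' k + beta k *: (W *m z' k) +
  beta k *: (Tz k - W *m Tz k) + alpha k *: g k.
Proof.
rewrite /z' zS (TzS k) !mulmxDr -!scalemxAr.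
move: (g k) (W *m z k) (W *m Tz k.+1) (W *m ez k) => h Wz WT We.
by apply/colP => i; rewrite !mxE; ring.
Qed.

(** Inserting the recursion of [z] into its increment yields [z' k - W *m z' k], which has Perron
    average 0: [z] disturbs the disagreement of [x] but not its average. *)
Let x'S k : x' k.+1 = (1 - beta k) *: x' k + beta k *: (W *m x' k) +
  beta k *: (tau k - W *m tau k - (Tz k - W *m Tz k)) +
  beta k *: (z' k - W *m z' k) - alpha k *: g k.
Proof.
rewrite /x' /tau /z' xS zS (TxS k) (TzS k) !(mulmxDr, mulmxN) -!scalemxAr.
move: (g k) (W *m x k) (W *m z k) (W *m Tx k.+1) (W *m Tz k.+1) (W *m ez k)
  (W *m ex k) => h Wx Wz WT WT' We We'.
by apply/colP => i; rewrite !mxE; ring.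
Qed.

Let n0 : 0 < n%:R :> R.
Proof. by rewrite ltr0n; case: n i0 => // -[]. Qed.

Let M0 : 0 <= M. Proof. exact: sumr_ge0. Qed.
Let K0_gt0 : 0 < K0. Proof. by rewrite ltr_wpDr// sumr_ge0. Qed.
Let K_gt0 : 0 < K. Proof. by rewrite mulr_gt0// ltr_wpDl. Qed.
Let C0 : 0 < C. Proof. exact: cnorm_C hN. Qed.
Let C2_gt0 : 0 < 2 * C. Proof. by rewrite mulr_gt0. Qed.
Let CK_gt0 : 0 < 2 * C * K. Proof. exact: mulr_gt0 C2_gt0 K_gt0. Qed.
Let nML : 0 < n%:R * (M + L). Proof. by rewrite mulr_gt0// ltr_wpDl. Qed.
Let D_gt0 : 0 < D.
Proof.
have C8 : 0 < 8 * C by rewrite mulr_gt0.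
have CK := CK_gt0.
by rewrite /D !addr_gt0.
Qed.
Let vT0 k : 0 <= vT k. Proof. by rewrite addr_ge0 ?vnorm_ge0. Qed.
Let tau_le k : vnorm (tau k) <= vT k. Proof. exact: vnormB. Qed.

Let A0 k : 0 <= A k. Proof. exact: normr_ge0. Qed.
Let X0 k : 0 <= X k. Proof. exact: cnorm_ge0. Qed.
Let Z0 k : 0 <= Z k. Proof. exact: cnorm_ge0. Qed.
Let delta0 k : 0 <= delta k. Proof. exact: vnorm_ge0. Qed.
Let ab0 k : 0 <= alpha k / beta k.
Proof. by have /andP[b0 _] := beta_range k; rewrite divr_ge0// ltW. Qed.

Let gradient_le i y : `|derive1 (f i) y| <= M + L * `|y - xstar|.
Proof.
have -> : derive1 (f i) y = derive1 (f i) xstar +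
    (derive1 (f i) y - derive1 (f i) xstar) by rewrite addrC subrK.
rewrite (le_trans (ler_normD _ _))// lerD//; last exact: smooth_gradient_le.
by rewrite /M (bigD1 i)//= lerDl sumr_ge0.
Qed.

Let x_dist k i : `|x k i 0 - wavg (x' k)| <= X k + vT k.
Proof.
have -> : x k i 0 - wavg (x' k) = dev (x' k) i 0 - tau k i 0.
  by rewrite /dev /x' !mxE mulr1; ring.
rewrite (le_trans (ler_normB _ _))// lerD//.
  exact: le_trans (vnorm_ge _ i) (cnorm_ge hN _).
exact: le_trans (vnorm_ge _ i) (tau_le k).
Qed.

Let g_le k : (forall i, `|kappa k i| <= K0) -> vT k <= 1 ->
  vnorm (g k) <= K * (1 + A k + X k).
Proof.
move=> kapK v1; have AX : 0 <= A k + X k by rewrite addr_ge0.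
apply: vnorm_le => [|i]; first by rewrite mulr_ge0 ?(ltW K_gt0)// -addrA addr_ge0.
rewrite mxE normrM /K -mulrA; apply: ler_pM => //.
apply: (le_trans (gradient_le _ _)); rewrite mulrDl lerD//.
  by rewrite -addrA mulrDr mulr1 lerDl mulr_ge0.
rewrite ler_pM2l//; have := x_dist k i.
have := ler_normD (x k i 0 - wavg (x' k)) (wavg (x' k) - xstar).
rewrite addrA subrK -/(A k); lra.
Qed.

(** Two causes are separated: gradients evaluated at the agents' own points instead of [y], and
    weights [r i 0 * kappa k i] different from [1 / n]. *)
Let avg_error k : (forall i, `|kappa k i| <= K0) ->
  `|wavg (g k) - avg_gradient f (wavg (x' k))| <=
  K * (X k + vT k) + n%:R * (M + L) * delta k * (1 + A k).
Proof.
move=> kapK; set y := wavg (x' k).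
have -> : wavg (g k) - avg_gradient f y =
    \sum_i (r i 0 * (kappa k i * (derive1 (f i) (x k i 0) - derive1 (f i) y)) +
      (r i 0 * kappa k i - n%:R^-1) * derive1 (f i) y).
  rewrite wavgE /avg_gradient mulr_sumr -sumrB; apply: eq_bigr => i _.
  by rewrite mxE; ring.
rewrite (le_trans (ler_norm_sum _ _ _))//.
have -> : K * (X k + vT k) + n%:R * (M + L) * delta k * (1 + A k) =
    \sum_i (r i 0 * (K * (X k + vT k)) + (M + L) * delta k * (1 + A k)).
  rewrite big_split/= -mulr_suml (perron_sum1 hr) mul1r sumr_const card_ord.
  by rewrite -[X in _ = _ + X]mulr_natl !mulrA.
apply: ler_sum => i _; rewrite (le_trans (ler_normD _ _))// lerD//.
  rewrite normrM gtr0_norm ?(perron_gt0 hr)// ler_pM2l ?(perron_gt0 hr)//.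
  rewrite normrM /K -mulrA; apply: ler_pM => //.
  apply: (le_trans (smooth_gradient_le _ _ (f_smooth i) _ _)).
  apply: (le_trans (ler_wpM2l (ltW L0) (x_dist k i))).
  by apply: ler_wpM2r; rewrite ?lerDr// addr_ge0.
rewrite normrM.
have -> : (M + L) * delta k * (1 + A k) = delta k * ((M + L) * (1 + A k)) by ring.
have dl : `|r i 0 * kappa k i - n%:R^-1| <= delta k.
  by have := vnorm_ge (\col_i (r i 0 * kappa k i - n%:R^-1)) i; rewrite mxE.
apply: ler_pM => //.
apply: (le_trans (gradient_le i y)); rewrite -/(A k) mulrDl.
rewrite lerD//; first by rewrite mulrDr mulr1 lerDl mulr_ge0.
by rewrite ler_pM2l// lerDr.
Qed.

Let cnorm_dev_sub v : N (dev (v - W *m v)) <= 4 * C * vnorm v.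
Proof.
apply: (le_trans (cnorm_dev _)).
have -> : 4 * C * vnorm v = 2 * C * (2 * vnorm v) by ring.
rewrite ler_pM2l ?mulr_gt0// (le_trans (vnormB _ _))//.
have W0 := network_ge0 hW.
have Wrow i : \sum_j W i j = 1.
  have := congr1 (fun v : 'cV[R]_n => v i 0) W1.
  by rewrite !mxE => <-; apply: eq_bigr => j _; rewrite mxE mulr1.
have := substochastic_vnorm W 1 v W0 Wrow ler01; lra.
Qed.

Let cnormN v : N (- v) <= N v.
Proof. by rewrite -scaleN1r (le_trans (cnormZ hN _ _))// normrN1 mul1r. Qed.

Let cnormZ_le b v K' : 0 <= b -> N v <= K' -> N (b *: v) <= b * K'.
Proof.
move=> b0 vK; apply: (le_trans (cnormZ hN _ _)).
by rewrite ger0_norm// ler_wpM2l.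
Qed.

Let dev_g_le k : (forall i, `|kappa k i| <= K0) -> vT k <= 1 ->
  N (alpha k *: dev (g k)) <= beta k * (alpha k / beta k * (2 * C * K) * (1 + A k + X k)).
Proof.
move=> kapK v1; have /andP[b0 _] := beta_range k.
have -> : beta k * (alpha k / beta k * (2 * C * K) * (1 + A k + X k)) =
  alpha k * (2 * C * (K * (1 + A k + X k))) by field; rewrite gt_eqF.
apply: cnormZ_le; first exact/ltW.
by apply: (le_trans (cnorm_dev _)); rewrite ler_pM2l ?mulr_gt0// g_le.
Qed.

Let eps_split k a b e : 0 <= a <= D -> 0 <= b <= D -> 0 <= e <= D ->
  vT k * a + alpha k / beta k * b + delta k * e <= eps k.
Proof.
move=> /andP[a0 aD] /andP[b0 bD] /andP[e0 eD]; rewrite /eps.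
have := ler_wpM2l (vT0 k) aD; have := ler_wpM2l (ab0 k) bD.
have := ler_wpM2l (delta0 k) eD; lra.
Qed.

Let D_ge : [/\ 8 * C <= D, 2 * C * K <= D, K <= D, 2 <= D & n%:R * (M + L) <= D].
Proof.
have C8 : 0 < 8 * C by rewrite mulr_gt0.
have CK := CK_gt0.
by have KK := K_gt0; have nn := nML; split; rewrite /D; lra.
Qed.

Let Z_step k : (forall i, `|kappa k i| <= K0) -> vT k <= 1 ->
  Z k.+1 <= (1 - c * beta k) * Z k + beta k * (eps k * (1 + A k + X k)).
Proof.
move=> kapK v1; have /andP[b0 b1] := beta_range k.
have AX1 : 1 <= 1 + A k + X k by rewrite -addrA lerDl addr_ge0.
set rhs := leRHS; rewrite /Z z'S !devD !devZ devW.
apply: (le_trans (cnormD hN _ _)).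
apply: (le_trans (lerD (cnormD hN _ _) (dev_g_le _ kapK v1))).
have H1 : N ((1 - beta k) *: dev (z' k) + beta k *: (W *m dev (z' k))) <=
    (1 - c * beta k) * Z k.
  by apply: cnorm_step; rewrite ?wavg_dev ?(ltW b0).
have H2 : N (beta k *: dev (Tz k - W *m Tz k)) <= beta k * (4 * C * vT k).
  apply: cnormZ_le; first exact/ltW.
  by rewrite (le_trans (cnorm_dev_sub _))// ler_pM2l ?mulr_gt0// lerDr vnorm_ge0.
have [D1 D2 _ _ _] := D_ge.
have E : vT k * (8 * C) + alpha k / beta k * (2 * C * K) + delta k * 0 <= eps k.
  by apply: eps_split; rewrite ?D1 ?D2 ?lexx ?(ltW D_gt0) ?(ltW CK_gt0) ?mulr_ge0// ltW.
have E' : (vT k * (8 * C) + alpha k / beta k * (2 * C * K)) * (1 + A k + X k) <=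
    eps k * (1 + A k + X k).
  by rewrite ler_wpM2r ?(le_trans ler01 AX1)//; move: E; rewrite mulr0 addr0.
have vC : 0 <= vT k * C by rewrite mulr_ge0// ltW.
have E2 := ler_wpM2l vC AX1.
have := ler_wpM2l (ltW b0) E'; have := ler_wpM2l (ltW b0) E2.
have := mulr_ge0 (ltW b0) vC; rewrite /rhs; move: H1 H2; lra.
Qed.

Let X_step k : (forall i, `|kappa k i| <= K0) -> vT k <= 1 ->
  X k.+1 <= (1 - c * beta k) * X k +
            beta k * (D * Z k + eps k * (1 + A k + X k)).
Proof.
move=> kapK v1; have /andP[b0 b1] := beta_range k.
have AX1 : 1 <= 1 + A k + X k by rewrite -addrA lerDl addr_ge0.
set rhs := leRHS; rewrite /X x'S !devD !devN !devZ devW.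
apply: (le_trans (cnormD hN _ _)).
apply: (le_trans (lerD (cnormD hN _ _) (le_trans (cnormN _) (dev_g_le _ kapK v1)))).
apply: (le_trans (lerD (lerD (cnormD hN _ _) (lexx _)) (lexx _))).
have H1 : N ((1 - beta k) *: dev (x' k) + beta k *: (W *m dev (x' k))) <=
    (1 - c * beta k) * X k.
  by apply: cnorm_step; rewrite ?wavg_dev ?(ltW b0).
have H2 : N (beta k *: dev (tau k - W *m tau k - (Tz k - W *m Tz k))) <=
    beta k * (8 * C * vT k).
  apply: cnormZ_le; first exact/ltW.
  rewrite devD devN; apply: (le_trans (cnormD hN _ _)).
  apply: (le_trans (lerD (cnorm_dev_sub _) (le_trans (cnormN _) (cnorm_dev_sub _)))).
  have -> : 8 * C * vT k = 4 * C * vT k + 4 * C * vT k by ring.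
  by rewrite lerD// ler_pM2l ?mulr_gt0// lerDr vnorm_ge0.
have H3 : N (beta k *: dev (z' k - W *m z' k)) <= beta k * (D * Z k).
  apply: cnormZ_le; first exact/ltW.
  rewrite devD devN devW.
  apply: (le_trans (cnormD hN _ _)).
  have rv : r^T *m dev (z' k) = 0.
    by apply/matrixP => i j; rewrite !ord1 -/(wavg (dev (z' k))) wavg_dev mxE.
  have := cnorm_contract hN rv; have := cnormN (W *m dev (z' k)).
  have /andP[c0 _] := cnorm_c hN.
  have [_ _ _ D2 _] := D_ge; have := ler_wpM2r (Z0 k) D2.
  have := mulr_ge0 (ltW c0) (Z0 k); rewrite -/(Z k); lra.
have [D1 D2 _ _ _] := D_ge.
have E : vT k * (8 * C) + alpha k / beta k * (2 * C * K) + delta k * 0 <= eps k.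
  by apply: eps_split; rewrite ?D1 ?D2 ?lexx ?(ltW D_gt0) ?(ltW CK_gt0) ?mulr_ge0// ltW.
have E' : (vT k * (8 * C) + alpha k / beta k * (2 * C * K)) * (1 + A k + X k) <=
    eps k * (1 + A k + X k).
  by rewrite ler_wpM2r ?(le_trans ler01 AX1)//; move: E; rewrite mulr0 addr0.
have vC : 0 <= vT k * C by rewrite mulr_ge0// ltW.
have E2 := ler_wpM2l vC AX1.
have := ler_wpM2l (ltW b0) E'; have := ler_wpM2l (ltW b0) E2.
have := mulr_ge0 (ltW b0) vC; rewrite /rhs; move: H1 H2 H3; lra.
Qed.

(** Every term [v - W *m v] has average 0, so the average makes an exact gradient step up to
    [avg_error]. The part [K * X k] of that error is not small and is charged to [D * X k]. *)
Let A_step k : (forall i, `|kappa k i| <= K0) -> alpha k * L <= 1 ->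
  A k.+1 <= (1 - mu * alpha k) * A k +
            alpha k * (D * X k + eps k * (1 + A k + X k)).
Proof.
move=> kapK aL; have a0 := alpha_gt0 k.
have AX1 : 1 <= 1 + A k + X k by rewrite -addrA lerDl addr_ge0.
have wS : wavg (x' k.+1) = wavg (x' k) - alpha k * wavg (g k).
  by rewrite x'S !(wavgD, wavgN, wavgZ, wavgW); ring.
rewrite /A wS.
rewrite (_ : _ - xstar = (wavg (x' k) - xstar - alpha k * avg_gradient f (wavg (x' k)))
   - alpha k * (wavg (g k) - avg_gradient f (wavg (x' k)))); last by ring.
apply: (le_trans (ler_normB _ _)); rewrite [mu * _]mulrC; apply: lerD.
  by apply: (avg_gradient_step f mu L) => //; exact: ltW.
rewrite normrM gtr0_norm// ler_pM2l//; apply: (le_trans (avg_error _ kapK)).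
have [_ _ D3 _ D5] := D_ge.
have E : vT k * K + alpha k / beta k * 0 + delta k * (n%:R * (M + L)) <= eps k.
  by apply: eps_split; rewrite ?D3 ?D5 ?lexx ?(ltW D_gt0) ?(ltW nML) ?(ltW K_gt0).
have E' : (vT k * K + delta k * (n%:R * (M + L))) * (1 + A k + X k) <=
    eps k * (1 + A k + X k).
  by rewrite ler_wpM2r ?(le_trans ler01 AX1)//; move: E; rewrite mulr0 addr0.
have vK : 0 <= vT k * K by rewrite mulr_ge0// ltW.
have dn : 0 <= delta k * (n%:R * (M + L)) by rewrite mulr_ge0// ltW.
have E1 := ler_wpM2l vK AX1; have E2 := mulr_ge0 dn (X0 k).
have E3 := ler_wpM2r (X0 k) D3.
rewrite -/(A k); move: E' E1 E2 E3; lra.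
Qed.

Let vT_cvg : vT @ \oo --> 0.
Proof. by rewrite -[X in _ --> X]addr0; exact: cvgD. Qed.

Let delta_cvg : delta @ \oo --> 0.
Proof.
apply: vnorm_cvg0 => i; have ri0 := perron_gt0 hr i.
have : (fun k => r i 0 * kappa k i - n%:R^-1) @ \oo -->
    r i 0 * (n%:R * r i 0)^-1 - n%:R^-1.
  by apply: cvgB; [exact: cvgMr|exact: cvg_cst].
rewrite (_ : _ - _ = 0); last by field; rewrite !gt_eqF.
by apply: cvg_trans; apply: near_eq_cvg; apply: nearW => k; rewrite mxE.
Qed.

Let eps_cvg : eps @ \oo --> 0.
Proof.
rewrite -[X in _ --> X](_ : D * (0 + 0 + 0) = 0); last by rewrite !addr0 mulr0.
by apply: cvgMr; apply: cvgD => //; exact: cvgD.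
Qed.

Let near_le (u : nat -> R) b : u @ \oo --> 0 -> 0 < b -> \forall k \near \oo, u k <= b.
Proof.
move=> /cvgrPdist_le H /H; apply: filterS => k.
by rewrite sub0r normrN; apply: le_trans; exact: ler_norm.
Qed.

Let kappa_bounded : \forall k \near \oo, forall i, `|kappa k i| <= K0.
Proof.
apply: filter_forall => i; have /cvgrPdist_le/(_ _ ltr01) := kappa_cvg i.
apply: filterS => k H; rewrite /K0 (bigD1 i)//= addrA.
set a := (_ * _)^-1 in H *.
have S0 : 0 <= \sum_(j | j != i) `|(n%:R * r j 0)^-1| by exact: sumr_ge0.
have := ler_normD (kappa k i - a) a; rewrite subrK distrC; lra.
Qed.

(** As [beta k <= 1], the limit [alpha_beta] already forces [alpha] to 0. *)
Let alpha_small b : 0 < b -> \forall k \near \oo, b * alpha k <= 1.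
Proof.
move=> b0; have b1 : 0 < b^-1 by rewrite invr_gt0.
have := near_le _ _ alpha_beta b1; apply: filterS => k.
have /andP[be0 be1] := beta_range k.
rewrite ler_pdivrMr// => H; rewrite mulrC -ler_pdivlMr// div1r (le_trans H)//.
by rewrite ler_piMr// ltW.
Qed.

Lemma optimization_cvg :
  [/\ (fun k => vnorm (dev (x k))) @ \oo --> 0,
      (fun k => vnorm (dev (z k))) @ \oo --> 0 &
      (fun k => wavg (x k)) @ \oo --> xstar].
Proof.
have /andP[c0 c1] := cnorm_c hN.
have [A_cvg X_cvg Z_cvg] : [/\ A @ \oo --> 0, X @ \oo --> 0 & Z @ \oo --> 0].
  apply: (coupled_recursion_cvg0 A X Z alpha beta eps c mu D) => //.
  - by move=> k; have /andP[] := beta_range k.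
  - move=> k; apply: mulr_ge0; first exact: ltW.
    exact: addr_ge0 (addr_ge0 (vT0 k) (ab0 k)) (delta0 k).
  - move=> k; have /andP[b0 b1] := beta_range k.
    by rewrite mulr_ile1// ltW.
  - exact: alpha_small.
  - near=> k; split.
    + by apply: Z_step; near: k; [exact: kappa_bounded|exact: near_le].
    + by apply: X_step; near: k; [exact: kappa_bounded|exact: near_le].
    + apply: A_step; first by near: k; exact: kappa_bounded.
      by rewrite mulrC; near: k; exact: alpha_small.
have squeeze (u h : nat -> R) (a : R) : (forall k, `|u k - a| <= h k) ->
    h @ \oo --> 0 -> u @ \oo --> a.
  move=> uh /cvgrPdist_le H; apply/cvgrPdist_le => eta /H; apply: filterS => k.
  rewrite sub0r normrN distrC => hk.
  by rewrite (le_trans (uh k))// (le_trans (ler_norm _)).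
have cvg2 (h : nat -> R) : h @ \oo --> 0 -> (fun k => h k + 2 * vT k) @ \oo --> 0.
  move=> hc; rewrite -[X in _ --> X](_ : 0 + 2 * 0 = 0); last by rewrite mulr0 addr0.
  by apply: cvgD => //; exact: cvgMr.
split.
- apply: (squeeze _ (fun k => X k + 2 * vT k)) (cvg2 _ X_cvg) => k.
  rewrite subr0 ger0_norm ?vnorm_ge0//.
  have -> : x k = x' k - tau k by rewrite /x' addrK.
  rewrite devD devN (le_trans (vnormB _ _))// lerD ?(cnorm_ge hN)//.
  by rewrite (le_trans (dev_le _))// ler_pM2l.
- apply: (squeeze _ (fun k => Z k + 2 * vT k)) (cvg2 _ Z_cvg) => k.
  rewrite subr0 ger0_norm ?vnorm_ge0//.
  have -> : z k = z' k - Tz k by rewrite /z' addrK.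
  rewrite devD devN (le_trans (vnormB _ _))// lerD ?(cnorm_ge hN)//.
  by rewrite (le_trans (dev_le _))// ler_pM2l// lerDr vnorm_ge0.
apply: (squeeze _ (fun k => A k + 2 * vT k)) (cvg2 _ A_cvg) => k.
have -> : wavg (x k) - xstar = wavg (x' k) - xstar - wavg (tau k).
  by rewrite /x' wavgD; ring.
rewrite (le_trans (ler_normB _ _))// lerD2l.
have := wavg_le (tau k); have := tau_le k; have := vT0 k; lra.
Unshelve. all: by end_near.
Qed.

End Optimization.

End Network.

(** * Convergence of the iteration *)

(** This extracts one agent's noise stream from the joint family. The left inverse [h'] transports
    the chosen sets to the larger index type and makes [h] injective, so the product reindexes. *)
Lemma mutually_independent_comp {d : measure_display} {T : measurableType d}
    {R : realType} (P : probability T R) (I J : choiceType)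
    (G : I -> set_system T) (h : J -> I) (h' : I -> J) : cancel h h' ->
  mutually_independent P G -> mutually_independent P (fun j => G (h j)).
Proof.
move=> hK indG J0 A HA.
have := indG [fset h j | j in J0]%fset (fun i => A (h' i)).
rewrite big_imfset => [|j k _ _ /(congr1 h')]; last by rewrite !hK.
under eq_bigr do rewrite hK.
move=> <-; last by move=> _ /imfsetP[j jJ ->]; rewrite hK; exact: HA.
congr (P _); apply/seteqP; split=> [w H i /= /imfsetP[j /= jJ ->]|w H j /= jJ].
  by rewrite hK; exact: H.
by rewrite -(hK j); apply: H; rewrite /=; apply/imfsetP; exists j.
Qed.

Lemma euclidean_norm_ge {R : rcfType} {n : nat} (v : 'rV[R]_n) j :
  `|v 0 j| <= euclidean_norm v.
Proof.
rewrite -sqrtr_sqr /euclidean_norm ler_wsqrtr// (bigD1 j)//= lerDl.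
by apply: sumr_ge0 => k _; exact: sqr_ge0.
Qed.

Lemma psum_inv_cvg0 {R : realType} (u : nat -> R) : (forall k, 0 < u k) ->
  (forall N A, exists m, A <= \sum_(N <= k < m) u k) ->
  (fun k => (psum u k)^-1) @ \oo --> 0.
Proof.
move=> u0 udiv; apply/cvgrPdist_le => eta eta0.
have [m Hm] := udiv 0%N eta^-1; exists m => // k /= mk.
have le_sum : eta^-1 <= psum u k.
  apply: (le_trans Hm); rewrite /psum (@big_cat_nat _ _ _ m 0 k.+1)//=; last exact: leqW.
  by rewrite lerDl sumr_ge0// => j _; exact: ltW.
have p0 : 0 < psum u k by apply: lt_le_trans le_sum; rewrite invr_gt0.
by rewrite sub0r normrN ger0_norm ?invr_ge0 ?(ltW p0)// invf_ple ?posrE.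
Qed.

Section PathwiseConvergence.
Context {R : realType} {n : nat}.
Variables (adj : rel 'I_n) (W : 'M[R]_n) (r : 'cV[R]_n).
Hypotheses (hW : network_matrix adj W) (hr : left_perron_vector W r).
Variables (f : 'I_n -> R -> R) (mu L xstar : R).
Hypotheses (mu_gt0 : 0 < mu) (L_gt0 : 0 < L).
Hypothesis f_convex : forall i, strongly_convex mu (f i).
Hypothesis f_smooth : forall i, smooth L (f i).
Hypothesis xstar_min : forall x, avg_objective f xstar <= avg_objective f x.
Variables (lambda gamma alpha beta : nat -> R) (eps : R) (x0 z0 : 'I_n -> R).
Hypothesis gamma_gt0 : forall k, 0 < gamma k.
Hypothesis alpha_gt0 : forall k, 0 < alpha k.
Hypothesis lambda_range : forall k, 0 < lambda k <= 1.
Hypothesis beta_range : forall k, 0 < beta k <= 1.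
Hypothesis gamma_div : forall N A, exists m, A <= \sum_(N <= k < m) gamma k.
Hypothesis alpha_div : forall N A, exists m, A <= \sum_(N <= k < m) alpha k.
Hypothesis beta_div : forall N A, exists m, A <= \sum_(N <= k < m) beta k.
Hypothesis ratio_lim :
  (fun k => (psum gamma k)^-1 * sup_ratio gamma lambda k) @ \oo --> 0.
Hypothesis Lambda_Gamma : (fun k => psum lambda k / psum gamma k) @ \oo --> 0.
Hypothesis alpha_beta : (fun k => alpha k / beta k) @ \oo --> 0.
Variables (ex ez : 'I_n -> nat -> R) (ey : 'I_n -> nat -> 'rV[R]_n) (s : R).
Hypothesis ex_cvg : forall i, cvgn (fun m => \sum_(0 <= k < m) beta k * ex i k).
Hypothesis ez_cvg : forall i, cvgn (fun m => \sum_(0 <= k < m) beta k * ez i k).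
Hypothesis ey_bound : forall i k, euclidean_norm (ey i k) <= s.

Let st k := RXi_row W f lambda gamma alpha beta eps x0 z0 ex ez ey k.
Let y k i j : R := st_y (st k) i 0 j.

(** For fixed [j], the [j]-th components of all agents obey the averaged recursion, and only agent
    [j] injects into them. So the input direction is [delta_mx j 0], with Perron average [r j 0]. *)
Let y_cvg i j : (fun k => y k.+1 i j / psum gamma k) @ \oo --> r j 0.
Proof.
have [c [C [N hN]]] := contracting_norm_exists adj W r hW hr.
pose u k : 'cV[R]_n := \col_i' y k i' j.
pose e k : 'cV[R]_n := \col_i' ey i' k 0 j.
have s0 : 0 <= s.
  by apply: le_trans (ey_bound i 0%N); rewrite sqrtr_ge0.
have -> : r j 0 = wavg r (delta_mx j 0).
  rewrite wavgE (bigD1 j)//= mxE !eqxx mulr1 big1 ?addr0// => l lj.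
  by rewrite mxE (negbTE lj) mulr0.
have e_le k : vnorm (e k) <= s.
  apply: vnorm_le => // l; rewrite mxE.
  exact: le_trans (euclidean_norm_ge _ _) (ey_bound l k).
have uS k : u k.+1 = (1 - lambda k) *: u k + lambda k *: (W *m u k + e k) +
    gamma k *: delta_mx j 0.
  apply/colP => l; rewrite !mxE /y /= !mxE summxE !eqxx /= andbT [j == l]eq_sym.
  congr (_ + _ * (_ + _) + _ * _).
  by apply: eq_bigr => l' _; rewrite !mxE.
have := eigenvector_estimate adj W r c C N hW hr hN lambda gamma u e
  (delta_mx j 0) s s0 gamma_gt0 lambda_range ratio_lim Lambda_Gamma
  (psum_inv_cvg0 gamma gamma_gt0 gamma_div) e_le uS i.
by apply: cvg_trans; apply: near_eq_cvg; apply: nearW => k; rewrite mxE.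
Qed.

(** The growing scale [psum gamma k] cancels in the quotient. The denominator entry grows like
    [r i 0 * psum gamma k], so it passes the threshold for good and the fallback branch is
    eventually never taken. *)
Let kappa_cvg i : (fun k => st_kappa (st k.+1) i) @ \oo --> (n%:R * r i 0)^-1.
Proof.
have ri0 := perron_gt0 hr i.
have n0 : 0 < n%:R :> R by rewrite ltr0n (leq_ltn_trans (leq0n i)).
have G0 k : 0 < psum gamma k.
  rewrite /psum big_nat_recr//= ltr_wpDl// sumr_ge0// => j _; exact/ltW.
pose q k := (\sum_j y k.+1 i j / psum gamma k) / (n%:R * (y k.+1 i i / psum gamma k)).
have q_cvg : q @ \oo --> (n%:R * r i 0)^-1.
  rewrite (_ : _^-1 = (\sum_j r j 0) / (n%:R * r i 0)); last first.
    by rewrite (perron_sum1 hr) mul1r.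
  apply: cvgM; first by apply: (cvg_big add_continuous) => j _; exact: y_cvg.
  apply: cvgV; first by rewrite gt_eqF// mulr_gt0.
  by apply: cvgMr; exact: y_cvg.
apply: cvg_trans q_cvg; apply: near_eq_cvg; near=> k.
have [y_large y_gt0] : eps < y k.+1 i i /\ 0 < y k.+1 i i.
  have half : r i 0 / 2 <= y k.+1 i i / psum gamma k.
    have : `|r i 0 - y k.+1 i i / psum gamma k| <= r i 0 / 2.
      by near: k; move/cvgrPdist_le : (y_cvg i i); apply; rewrite divr_gt0.
    by move=> /ler_normlP[_]; lra.
  (* Together with [half] this puts the entry above [|eps| + 1], hence above both [eps] and 0. *)
  have large : 2 * (`|eps| + 1) / r i 0 < psum gamma k.
    have b0 : 0 < 2 * (`|eps| + 1) / r i 0 by rewrite divr_gt0// mulr_gt0// ltr_wpDl.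
    rewrite -ltf_pV2 ?posrE//.
    have : `|0 - (psum gamma k)^-1| < (2 * (`|eps| + 1) / r i 0)^-1.
      near: k; move/cvgrPdist_lt : (psum_inv_cvg0 gamma gamma_gt0 gamma_div).
      by apply; rewrite invr_gt0 divr_gt0// mulr_gt0// ltr_wpDl.
    by rewrite sub0r normrN => /(le_lt_trans (ler_norm _)).
  move: half large; rewrite ler_pdivlMr// ltr_pdivrMr// => half large.
  have := ler_norm eps; have := normr_ge0 eps; split; lra.
have -> : st_kappa (st k.+1) i = if eps < y k.+1 i i
    then (\sum_j y k.+1 i j) / (n%:R * y k.+1 i i) else st_kappa (st k) i by [].
by rewrite y_large /q -mulr_suml; field; rewrite !gt_eqF.
Unshelve. all: by end_near.
Qed.

Lemma RXi_row_pathwise_cvg i :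
  [/\ (fun k => `|st_x (st k) i - weighted_avg r (st_x (st k))|) @ \oo --> 0,
      (fun k => `|st_z (st k) i - weighted_avg r (st_z (st k))|) @ \oo --> 0 &
      (fun k => avg_objective f (st_x (st k) i)) @ \oo --> avg_objective f xstar].
Proof.
have [c [C [N hN]]] := contracting_norm_exists adj W r hW hr.
pose xv k : 'cV[R]_n := \col_i st_x (st k) i.
pose zv k : 'cV[R]_n := \col_i st_z (st k) i.
pose exv k : 'cV[R]_n := \col_i ex i k.
pose ezv k : 'cV[R]_n := \col_i ez i k.
(* The remainder starts at index [k] itself, so passing to [k.+1] releases exactly the noise used in
   step [k]. *)
pose tail (e : 'I_n -> nat -> R) k : 'cV[R]_n := \col_i
  (limn (fun m => \sum_(0 <= t < m) beta t * e i t) - \sum_(0 <= t < k) beta t * e i t).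
have tailS (e : 'I_n -> nat -> R) k : tail e k = tail e k.+1 + beta k *: \col_i e i k.
  by apply/colP => j; rewrite !mxE big_nat_recr//=; ring.
have tail_cvg (e : 'I_n -> nat -> R) :
    (forall i, cvgn (fun m => \sum_(0 <= t < m) beta t * e i t)) ->
    (fun k => vnorm (tail e k)) @ \oo --> 0.
  move=> ecv; apply: vnorm_cvg0 => j.
  have : (fun k => limn (fun m => \sum_(0 <= t < m) beta t * e j t) -
      \sum_(0 <= t < k) beta t * e j t) @ \oo -->
      limn (fun m => \sum_(0 <= t < m) beta t * e j t) -
      limn (fun m => \sum_(0 <= t < m) beta t * e j t).
    by apply: cvgB; [exact: cvg_cst|exact: ecv].
  rewrite subrr; apply: cvg_trans; apply: near_eq_cvg.
  by apply: nearW => k; rewrite mxE.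
have zS k : zv k.+1 = (1 - beta k) *: zv k + beta k *: (W *m zv k + ezv k) +
    alpha k *: \col_j (st_kappa (st k.+1) j * derive1 (f j) (xv k j 0)).
  apply/colP => j; rewrite !mxE [LHS]/=.
  congr (_ + _ * (_ + _) + _); first by apply: eq_bigr => l _; rewrite mxE.
  by rewrite -mulrA.
have xS k : xv k.+1 = (1 - beta k) *: xv k + beta k *: (W *m xv k + exv k) -
    (zv k.+1 - zv k).
  apply/colP => j; rewrite !mxE [LHS]/=.
  by congr (_ + _ * (_ + _) - _); apply: eq_bigr => l _; rewrite mxE.
have [dx dz wx] := optimization_cvg adj W r c C N hW hr hN f mu L xstar i mu_gt0
  L_gt0 f_convex f_smooth xstar_min alpha beta (fun k i => st_kappa (st k.+1) i)
  xv zv exv ezv (tail ex) (tail ez) alpha_gt0 beta_range alpha_div beta_div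
  alpha_beta kappa_cvg (tailS ex) (tailS ez) (tail_cvg _ ex_cvg) (tail_cvg _ ez_cvg)
  zS xS.
have wE v : weighted_avg r v = wavg r (\col_i v i).
  by rewrite wavgE; apply: eq_bigr => j _; rewrite mxE.
have devE v : `|v i - weighted_avg r v| <= vnorm (dev r (\col_i v i)).
  by have := vnorm_ge (dev r (\col_i v i)) i; rewrite !mxE mulr1 wE.
have squeeze0 (u h : nat -> R) : (forall k, 0 <= u k <= h k) ->
    h @ \oo --> 0 -> u @ \oo --> 0.
  by move=> uh hc; apply: (squeeze_cvgr _ (cvg_cst 0) hc); exact: nearW.
have x_dev : (fun k => `|st_x (st k) i - weighted_avg r (st_x (st k))|) @ \oo --> 0.
  by apply: squeeze0 dx => k; rewrite normr_ge0 devE.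
have x_cvg : (fun k => `|st_x (st k) i - xstar|) @ \oo --> 0.
  apply: (squeeze0 _ (fun k => `|st_x (st k) i - weighted_avg r (st_x (st k))|
     + `|wavg r (xv k) - xstar|)) => [k|].
    rewrite normr_ge0 /= wE -/(xv k); apply: le_trans (ler_normD _ _).
    by rewrite addrA subrK.
  rewrite -[X in _ --> X]addr0; apply: cvgD => //.
  by rewrite -(normr0 R) -(subrr xstar); apply: cvg_norm; apply: cvgB => //; exact: cvg_cst.
split => //; first by apply: squeeze0 dz => k; rewrite normr_ge0 devE.
apply/subr_cvg0/norm_cvg0P.
apply: (squeeze0 _ (fun k => L * `|st_x (st k) i - xstar| ^+ 2)) => [k|].
  by rewrite normr_ge0 (avg_objective_gap f mu L).
rewrite -[X in _ --> X](_ : L * (0 * 0) = 0); last by rewrite !mulr0.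
by apply: cvgMr; under eq_fun do rewrite expr2; exact: cvgM.
Qed.

End PathwiseConvergence.

Theorem theorem1 (R : realType) (d : measure_display) (T : measurableType d)
    (P : probability T R) (n : nat)
    (* network *)
    (adj : rel 'I_n) (W : 'M[R]_n) (r : 'cV[R]_n)
    (hW : network_matrix adj W) (hr : left_perron_vector W r)
    (* problem *)
    (f : 'I_n -> R -> R) (mu L : R) (mu_gt0 : 0 < mu) (L_gt0 : 0 < L)
    (f_convex : forall i, strongly_convex mu (f i))
    (f_smooth : forall i, smooth L (f i))
    (xstar : R)
    (hxstar : forall x : R, avg_objective f xstar <= avg_objective f x)
    (* noise *)
    (ex ez : 'I_n -> nat -> {RV P >-> R})
    (ey : 'I_n -> nat -> {RV P >-> n.-tuple R})
    (sigma sigma_y : R) (sigma_gt0 : 0 < sigma)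
    (hnoise : noise_assumption ex ez ey sigma sigma_y)
    (* iteration parameters *)
    (lambda gamma alpha beta : nat -> R) (eps : R) (x0 z0 : 'I_n -> R)
    (eps_gt0 : 0 < eps)
    (gamma_gt0 : forall k, 0 < gamma k) (alpha_gt0 : forall k, 0 < alpha k)
    (* gains of the eigenvector estimation *)
    (lambda_dec : forall k l, (k <= l)%N -> lambda l <= lambda k)
    (lambda_range : forall k, 0 < lambda k <= 1)
    (lambda_sum : (\sum_(0 <= k <oo) (lambda k)%:E = +oo)%E)
    (gamma_sum : (\sum_(0 <= k <oo) (gamma k)%:E = +oo)%E)
    (ratio_lim : (fun k => (psum gamma k)^-1 * sup_ratio gamma lambda k) @ \oo --> 0)
    (Lambda_Gamma : (fun k => psum lambda k / psum gamma k) @ \oo --> 0)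
    (* gains of the optimization *)
    (beta_range : forall k, 0 < beta k <= 1)
    (alpha_sum : (\sum_(0 <= k <oo) (alpha k)%:E = +oo)%E)
    (beta_sum : (\sum_(0 <= k <oo) (beta k)%:E = +oo)%E)
    (beta_sq_sum : (\sum_(0 <= k <oo) (beta k ^+ 2)%:E < +oo)%E)
    (alpha_sq_beta_sum : (\sum_(0 <= k <oo) (alpha k ^+ 2 / beta k)%:E < +oo)%E)
    (alpha_beta : (fun k => alpha k / beta k) @ \oo --> 0)
    (alpha_ratio_sum : (\sum_(0 <= k <oo)
      (alpha k * ((1 + sup_ratio gamma lambda k) / psum gamma k) ^+ 2)%:E < +oo)%E) :
  let st (w : T) (k : nat) :=
    RXi_row W f lambda gamma alpha beta eps x0 z0
      (fun i k => ex i k w) (fun i k => ez i k w)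
      (fun i k => row_of_tuple (ey i k w)) k in
  let x w i k := st_x (st w k) i in
  let z w i k := st_z (st w k) i in
  let xtilde w k := weighted_avg r (st_x (st w k)) in
  let ztilde w k := weighted_avg r (st_z (st w k)) in
  forall i : 'I_n, {ae P, forall w,
    [/\ (fun k => `|x w i k - xtilde w k|) @ \oo --> 0,
        (fun k => `|z w i k - ztilde w k|) @ \oo --> 0 &
        (fun k => avg_objective f (x w i k)) @ \oo --> avg_objective f xstar]}.
Proof.
move=> st x z xtilde ztilde i.
have [indep mx mz _ vx vz _ ybound] := hnoise.
have series_cvg (e : nat -> {RV P >-> R}) :
    mutually_independent P (fun k => sigma_of (e k)) ->
    (forall k, ('E_P[e k] = 0)%E) -> (forall k, ('V_P[e k] <= sigma%:E)%E) ->
    {ae P, forall w, cvgn (fun m => \sum_(0 <= k < m) beta k * e k w)}.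
  move=> ind m v; apply: (independent_series_cvg P e beta sigma) => //.
    by move=> k; rewrite -(m k) unlock.
  (* For a centred variable the variance is the second moment. *)
  move=> k; have := v k; rewrite /variance covariance.unlock m.
  rewrite unlock; congr (_ <= _)%E; apply: eq_integral => w _.
  by rewrite /= fctE /= !subr0 expr2.
have ex_cvg : {ae P, forall w, forall i, cvgn (fun m => \sum_(0 <= k < m) beta k * ex i k w)}.
  apply: filter_forall => j; apply: series_cvg => //.
  (* The [match] only has to invert the embedding of times on its image; the default 0 elsewhere is
     arbitrary. *)
  apply: (mutually_independent_comp P _ _ _ (fun k => inl (inl (j, k)))
    (fun a => match a with inl (inl (_, k)) => k | _ => 0%N end) _ indep) => //.
have ez_cvg : {ae P, forall w, forall i, cvgn (fun m => \sum_(0 <= k < m) beta k * ez i k w)}.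
  apply: filter_forall => j; apply: series_cvg => //.
  apply: (mutually_independent_comp P _ _ _ (fun k => inl (inr (j, k)))
    (fun a => match a with inl (inr (_, k)) => k | _ => 0%N end) _ indep) => //.
have beta_gt0 k : 0 < beta k by have /andP[] := beta_range k.
(* The remaining argument is deterministic on the intersection of three almost sure events: both
   families of series converge and the [ey] are bounded. *)
near=> w.
apply: (RXi_row_pathwise_cvg adj W r hW hr f mu L xstar mu_gt0 L_gt0 f_convex f_smooth hxstar
  lambda gamma alpha beta eps x0 z0 gamma_gt0 alpha_gt0 lambda_range beta_range
  _ _ _ ratio_lim Lambda_Gamma alpha_beta (fun i k => ex i k w) (fun i k => ez i k w)
      (fun i k => row_of_tuple (ey i k w)) sigma_y).
- by apply: nneseries_oo_partial => // k; exact: ltW.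
- by apply: nneseries_oo_partial => // k; exact: ltW.
- by apply: nneseries_oo_partial => // k; exact: ltW.
- by near: w.
- by near: w.
- by near: w.
Unshelve. all: by end_near.
Qed.
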